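(* There is an algorithm which, given an AT-free graph $G=(V,E)$ (finite, simple, connected, with no isolated vertices) with $|V|=n$ and $|E|=m$, computes a minimum cardinality paired dominating set of $G$ in $O(n^{8.5})$ time.
   Context: For a graph $G=(V,E)$, a set $D\subseteq V$ is dominating if every vertex of $V\setminus D$ has a neighbour in $D$. For a graph with no isolated vertices, a paired dominating set is a dominating set $D$ such that the induced subgraph $G[D]$ has a perfect matching. Three pairwise non-adjacent vertices form an asteroidal triple if for any two of them there is a path between them avoiding the closed neighbourhood of the third; a graph is AT-free if it has no asteroidal triple. *)

(* Defs.v *)
From Stdlib Require Import Reals.
From mathcomp Require Import all_boot.

Set Implicit Arguments.
Unset Strict Implicit.
Unset Printing Implicit Defensive.

(* The key R is rebound to ring_scope by the second import. *)
Delimit Scope R_scope with Re.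

Section Graphs.
Variables (T : finType) (e : rel T).

Definition simple_graph : Prop := symmetric e /\ irreflexive e.

(* The graph with no vertices is not connected. *)
Definition connected_graph : Prop :=
  0 < #|T| /\ forall x y, connect e x y.

Definition no_isolated : Prop := forall x, exists y, e x y.

Definition closed_nbh (z : T) : {set T} := [set u | (u == z) || e z u].

Definition path_avoiding (A : {set T}) (x y : T) : Prop :=
  exists p : seq T,
    [/\ path e x p, last x p = y & forall u, u \in x :: p -> u \notin A].

Definition asteroidal_triple (x y z : T) : Prop :=
  [/\ uniq [:: x; y; z],
      [/\ ~~ e x y, ~~ e y z & ~~ e x z],
      path_avoiding (closed_nbh z) x y,
      path_avoiding (closed_nbh x) y z &
      path_avoiding (closed_nbh y) x z].

Definition AT_free : Prop := forall x y z, ~ asteroidal_triple x y z.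

Definition dominating (D : {set T}) : Prop :=
  forall x, x \notin D -> exists2 y, y \in D & e x y.

Definition edges : {set {set T}} :=
  [set [set p.1; p.2] | p : T * T & e p.1 p.2].

(* [edges ::&: D] is the edge set of the subgraph induced by [D]. *)
Definition perfect_matching_on (D : {set T}) (M : {set {set T}}) : Prop :=
  [/\ M \subset edges ::&: D, trivIset M & cover M = D].

Definition paired_dominating (D : {set T}) : Prop :=
  dominating D /\ exists M, perfect_matching_on D M.

Definition minimum_paired_dominating (D : {set T}) : Prop :=
  paired_dominating D /\ forall D', paired_dominating D' -> #|D| <= #|D'|.

End Graphs.

(* The machine model is a word RAM programmed by structured programs.  A
   program is a fixed finite term, so it uses finitely many registers; memory
   is addressed by computed words.  All values are words, i.e. naturals
   smaller than a bound [W]; a computation that leaves this range has no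
   outcome. *)
Inductive binop := OAdd | OSub | OMul | ODiv | OMod | OEq | OLt.

Inductive expr :=
  | Const of nat
  | Reg of nat
  | Mem of expr
  | Op of binop & expr & expr.

Inductive cmd :=
  | Skip
  | Assign of nat & expr
  | Store of expr & expr
  | Seq of cmd & cmd
  | If of expr & cmd & cmd
  | While of expr & cmd.

Record state := State { regs : nat -> nat; memory : nat -> nat }.

(* [OSub] is truncated, and division by zero follows [divn] and [modn]. *)
Definition binop_val (o : binop) (u v : nat) : nat :=
  match o with
  | OAdd => u + v
  | OSub => u - v
  | OMul => u * v
  | ODiv => u %/ v
  | OMod => u %% v
  | OEq => u == v
  | OLt => u < v
  end.

Definition word (W v : nat) : option nat := if v < W then Some v else None.

Fixpoint eval (W : nat) (s : state) (a : expr) : option nat :=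
  match a with
  | Const c => word W c
  | Reg x => word W (regs s x)
  | Mem b => obind (fun i => word W (memory s i)) (eval W s b)
  | Op o b c =>
      obind (fun u => obind (fun v => word W (binop_val o u v)) (eval W s c))
            (eval W s b)
  end.

(* One step for each constant, register access, load and operation. *)
Fixpoint cost (a : expr) : nat :=
  match a with
  | Const _ | Reg _ => 1
  | Mem b => (cost b).+1
  | Op _ b c => (cost b + cost c).+1
  end.

(* [exec W c s t s']: with word bound [W], the command [c] started in [s]
   halts in [s'] after exactly [t] steps.  Nonzero words are true. *)
Inductive exec (W : nat) : cmd -> state -> nat -> state -> Prop :=
  | exec_skip s : exec W Skip s 1 s
  | exec_assign s x a v :
      eval W s a = Some v ->
      exec W (Assign x a) s (cost a).+1
        (State [eta regs s with x |-> v] (memory s))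
  | exec_store s a b i v :
      eval W s a = Some i -> eval W s b = Some v ->
      exec W (Store a b) s (cost a + cost b).+1
        (State (regs s) [eta memory s with i |-> v])
  | exec_seq c1 c2 s1 s2 s3 t1 t2 :
      exec W c1 s1 t1 s2 -> exec W c2 s2 t2 s3 ->
      exec W (Seq c1 c2) s1 (t1 + t2) s3
  | exec_if a c1 c2 s s' v t :
      eval W s a = Some v ->
      exec W (if v == 0 then c2 else c1) s t s' ->
      exec W (If a c1 c2) s (cost a + t).+1 s'
  | exec_while_stop a c s :
      eval W s a = Some 0 ->
      exec W (While a c) s (cost a).+1 s
  | exec_while_loop a c s1 s2 s3 v t1 t2 :
      eval W s1 a = Some v -> v != 0 ->
      exec W c s1 t1 s2 -> exec W (While a c) s2 t2 s3 ->
      exec W (While a c) s1 (cost a + t1 + t2).+1 s3.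

(* A graph on {0, ..., n-1} is presented by [n] in register 0 and its
   adjacency matrix, row by row, in memory cells 0, ..., n*n-1; everything
   else is initially 0. *)
Definition adj_cell (n : nat) (e : rel 'I_n) (a : nat) : nat :=
  [exists i : 'I_n, exists j : 'I_n, (a == i * n + j) && e i j].

Definition input_state (n : nat) (e : rel 'I_n) : state :=
  State (fun x => if x == 0 then n else 0) (adj_cell e).

(* A vertex set is returned as its 0/1 indicator vector in cells
   0, ..., n-1. *)
Definition outputs (n : nat) (s : state) (D : {set 'I_n}) : Prop :=
  forall i : 'I_n, memory s i = (i \in D).

(* Main.v *)
Require Import Defs.
From Stdlib Require Import Reals Lra.
From mathcomp Require Import all_boot zify.

(** A paired dominating set contains two vertices per matching edge.  Conversely,
    k edges whose ends dominate the graph give a paired dominating set of at most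
    2k vertices: take the edges one by one, and match an end whose partner is
    already used with another free neighbour, or leave it out if it has none.  So
    the problem is to find a minimum number of edges whose ends dominate.

    An AT-free graph has a vertex x such that no u, v admit both a u-x path
    avoiding N[v] and a v-x path avoiding N[u]: maximize the components of
    G - N[x].  From such an x there is a shortest path x_0, ..., x_d for which each
    vertex at distance i from x lies in N[x_i] or N[x_(i-1)].  Exchanging edges for
    edges of this path shows that some minimum cover has at most three edges with
    lower ends in any four consecutive levels.  Sorted by level, the edges that
    matter for a vertex are then among three consecutive ones.

    The algorithm tries every x, scans the vertices by distance from x, and keeps a
    table of best covers indexed by the last three edges.  The table has n^6 entries
    and a vertex is processed in time O(n^6), hence O(n^8) in total. *)

(** Four is where the exchange balances. Edges with lower ends in levels a to a+3 dominate only
    levels a-1 to a+5, and the path vertices x_(a-2), ..., x_(a+5) that dominate these levels are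
    eight, the ends of four path edges.

    The special vertex x is never recognized by the algorithm. From every start the surviving table
    entries are genuine edge covers; the bound on nearby edges only shows that a good start misses
    no minimum.

    Extending each of the n^6 triples by each of n^2 edges would cost n^8 per vertex. But appending
    an edge forgets the oldest of the three, so the best oldest edge is determined once for each
    pair of newer ones, and n^6 steps suffice.

    On the machine a computation that overflows has no outcome. The program is therefore written in
    a small language with a total semantics and a syntactic check that bounds all values; overflow
    and running time are then treated once for all programs, apart from the algorithm. *)

Set Implicit Arguments.
Unset Strict Implicit.
Unset Printing Implicit Defensive.

(** * AT-free graphs *)

Section ATFree.
Variables (T : finType) (e : rel T).
Hypotheses (es : symmetric e) (ei : irreflexive e).

Implicit Types (A : {set T}) (x y z u v w : T).

Local Notation N := (closed_nbh e).

Lemma in_nbh z u : (u \in N z) = (u == z) || e z u.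
Proof. by rewrite inE. Qed.

Lemma nbh_sym z u : (u \in N z) = (z \in N u).
Proof. by rewrite !in_nbh eq_sym es. Qed.

Definition avoid (A : {set T}) u v := [&& e u v, u \notin A & v \notin A].
Arguments avoid A u v /.

Definition reach (A : {set T}) x y := (x \notin A) && connect (avoid A) x y.

Lemma avoid_sym A : connect_sym (avoid A).
Proof.
by apply: sym_connect_sym => u v; rewrite /= es; congr (_ && _); rewrite andbC.
Qed.

Lemma reach_cons A x y z : x \notin A -> e x y -> reach A y z -> reach A x z.
Proof.
move=> xA exy /andP[yA c]; rewrite /reach xA; apply: connect_trans c.
by apply: connect1; rewrite /= exy xA.
Qed.

Lemma reach_end A x y : reach A x y -> y \notin A.
Proof.
case/andP=> xA /connectP[p]; elim: p x xA => [|z p ih] x xA /=; first by move=> _ ->.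
by move=> /andP[/and3P[_ _ zA] hp] hy; apply: ih hy.
Qed.

Lemma reach_avoiding A x y : reach A x y -> path_avoiding e A x y.
Proof.
case/andP=> xA /connectP[p]; elim: p x xA => [|z p ih] x xA /=.
  by move=> _ ->; exists [::]; split=> // u; rewrite inE => /eqP ->.
move=> /andP[/and3P[exz _ zA] hp] hy; have [q [q1 q2 q3]] := ih z zA hp hy.
exists (z :: q); split=> //=; first by rewrite exz.
by move=> u; rewrite inE => /predU1P[->//|]; apply: q3.
Qed.

Definition unrelated x u v := reach (N v) u x && reach (N u) v x.

Definition admissible x := forall u v, ~~ unrelated x u v.

Let comp z w := [set u | connect (avoid (N z)) w u].

Lemma admissible_exists : AT_free e -> 0 < #|T| -> exists x, admissible x.
Proof.
move=> AT /card_gt0P[x0 _].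
(* A component of size c contributes c * n ^ c to [Psi z]. With base [n = #|T|], enlarging a
   component by one vertex outweighs the loss of any component that was not larger. *)
pose n := #|T|; pose Psi z := \sum_(w | w \notin N z) n ^ #|comp z w|.
have [x _ xmax] := @arg_maxnP _ x0 xpredT Psi isT; exists x.
(* If [u] and [v] were unrelated with respect to [x], they would lie in different
   components of G - N[x].  With the component of [u] the smaller one, passing
   from [x] to [u] loses only that component, keeps all others inside components
   of G - N[u], and merges the component of [v] with [x]: [Psi] increases. *)
have main u v : reach (N v) u x -> reach (N u) v x ->
    #|comp x u| <= #|comp x v| -> False.
  move=> uv vu le_uv.
  have xv := reach_end uv; have xu := reach_end vu.
  have ux : u \notin N x by rewrite nbh_sym.
  have vx : v \notin N x by rewrite nbh_sym.
  have nconn : ~~ connect (avoid (N x)) u v.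
    apply/negP => c; apply: (AT u v x); split.
    - rewrite /= !inE !negb_or.
      move: ux vx; rewrite !in_nbh !negb_or => /andP[-> _] /andP[-> _].
      by case/andP: vu; rewrite in_nbh negb_or eq_sym => /andP[-> _].
    - split; last 1 first.
      + by move: xu; rewrite in_nbh negb_or => /andP[].
      + by case/andP: vu; rewrite in_nbh negb_or => /andP[].
      + by move: xv; rewrite in_nbh negb_or => /andP[].
    - by apply: reach_avoiding; rewrite /reach ux.
    - exact: reach_avoiding.
    - exact: reach_avoiding.
  pose Cu := comp x u; pose W := [set w | (w \notin N x) && (w \notin Cu)].
  have inW w : (w \in W) = (w \notin N x) && ~~ connect (avoid (N x)) u w.
    by rewrite in_set; congr (_ && ~~ _); rewrite inE.
  have vW : v \in W by rewrite inW vx nconn.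
  have WNu w : w \in W -> w \notin N u.
    rewrite inW (in_nbh u) => /andP[wx wn].
    apply/norP; split; first by apply: contraNneq wn => ->; rewrite connect0.
    by apply: contraNN wn => euw; apply: connect1; rewrite /= euw ux wx.
  have step w y : w \in W -> connect (avoid (N x)) w y ->
      (y \in W) && reach (N u) w y.
    move=> wW /connectP[p]; elim: p w wW => [|z p ih] w wW /=.
      by move=> _ ->; rewrite wW /reach connect0 WNu.
    move=> /andP[/and3P[ewz wx zx] hp] hy.
    have zW : z \in W.
      move: wW; rewrite !inW zx => /andP[_]; apply: contraNN => c.
      by apply: connect_trans c _; apply: connect1; rewrite /= es ewz zx.
    by have /andP[-> r] := ih z zW hp hy; apply: reach_cons ewz r; apply: WNu.
  have subc w : w \in W -> comp x w \subset comp u w.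
    by move=> wW; apply/subsetP => y; rewrite !inE => /(step w y wW)/andP[_ /andP[]].
  have xW : x \notin W by rewrite inW in_nbh eqxx.
  have n0 : 0 < n by apply/card_gt0P; exists x.
  have leW : \sum_(w in W) n ^ #|comp x w| <= \sum_(w in W) n ^ #|comp u w|.
    by apply: leq_sum => w wW; apply: leq_pexp2l => //; apply: subset_leq_card; apply: subc.
  (* In G - N[u] the component of [x] contains [x] and the whole old component of [v], so the new
     summand for [x] alone pays for the component that is lost. *)
  have big : n ^ #|comp x v|.+1 <= n ^ #|comp u x|.
    apply: leq_pexp2l => //.
    have <- : #|x |: comp x v| = #|comp x v|.+1.
      rewrite cardsU1; suff -> : x \notin comp x v by [].
      rewrite inE; apply/negP => /(step v x vW)/andP[/idPn]; by rewrite xW.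
    apply: subset_leq_card; apply/subsetP => y; rewrite in_setU1 !inE.
    have cvx : connect (avoid (N u)) x v by rewrite avoid_sym; case/andP: vu.
    case/predU1P => [->|/(step v y vW)/andP[_ /andP[_ c]]]; first exact: connect0.
    exact: connect_trans c.
  have Psiu : Psi u >= \sum_(w in W) n ^ #|comp u w| + n ^ #|comp u x|.
    rewrite /Psi (bigD1 x xu) /= addnC leq_add2l.
    rewrite [X in _ <= X](bigID (mem W)) /=; apply: leq_trans (leq_addr _ _).
    rewrite [X in _ <= X](eq_bigl (mem W)) // => w; rewrite andbC.
    case wW: (w \in W) => //=; rewrite WNu //=.
    by rewrite wW; apply/eqP => wx; move: xW; rewrite -wx wW.
  have Psix : Psi x = \sum_(w in W) n ^ #|comp x w| + \sum_(w in Cu) n ^ #|comp x w|.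
    rewrite /Psi (bigID (mem W)) /=; congr (_ + _); apply: eq_bigl => w.
      by rewrite inW andbA andbb.
    rewrite inW [w \in Cu]inE; case wx: (w \in N x) => /=; last by rewrite negbK.
    apply/esym/negbTE/negP => c.
    have /reach_end : reach (N x) u w by rewrite /reach ux.
    by rewrite wx.
  have sumC : \sum_(w in Cu) n ^ #|comp x w| = #|Cu| * n ^ #|Cu|.
    rewrite -sum_nat_const; apply: eq_bigr => w; rewrite inE => c; congr (_ ^ _).
    apply: eq_card => y; rewrite !inE; apply/idP/idP; apply: connect_trans => //.
    by rewrite avoid_sym.
  have Cun : #|Cu| < n.
    rewrite /n -cardsT; apply: proper_card; apply/properP; split; first exact: subsetT.
    exists x; rewrite ?inE //; apply/negP => c.
    have /reach_end : reach (N x) u x by rewrite /reach ux.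
    by rewrite in_nbh eqxx.
  have lt : \sum_(w in Cu) n ^ #|comp x w| < n ^ #|comp x v|.+1.
    rewrite sumC expnS; apply: (@leq_trans (n * n ^ #|Cu|)).
      by rewrite ltn_mul2r Cun expn_gt0 n0.
    by rewrite leq_mul2l leq_pexp2l ?orbT.
  have : Psi u <= Psi x := xmax u isT; rewrite leqNgt => /negP; apply.
  rewrite Psix; apply: leq_trans Psiu; rewrite -addnS leq_add //; exact: leq_trans big.
move=> u v; apply/negP => /andP[uv vu].
case/orP: (leq_total #|comp x u| #|comp x v|); exact: main.
Qed.

(** * Distance levels and a dominating shortest path *)

Record level (x : T) (lv : T -> nat) : Prop := Level {
  level0 : forall u, (lv u == 0) = (u == x);
  level_edge : forall u v, e u v -> lv v <= (lv u).+1;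
  level_pred : forall u i, lv u = i.+1 -> exists2 v, e v u & lv v = i
}.

Lemma level_exists x : (forall u, connect e x u) ->
  exists2 lv, level x lv & forall u, lv u < #|T|.
Proof.
move=> conn; pose P u i := [exists p : i.-tuple T, path e x p && (last x p == u)].
have PP u p : path e x p -> last x p = u -> P u (size p).
  by move=> hp hu; apply/existsP; exists (in_tuple p); rewrite /= hp hu eqxx.
have exP u : exists i, P u i.
  by have /connectP[p hp hu] := conn u; exists (size p); apply: PP.
have PQ u i : P u i -> exists p, [/\ path e x p, last x p = u & size p = i].
  by move=> /existsP[p /andP[hp /eqP hu]]; exists p; rewrite size_tuple.
pose lv u := ex_minn (exP u).
have lvP u : P u (lv u) by rewrite /lv; case: ex_minnP.
have lv_min u i : P u i -> lv u <= i.
  by rewrite /lv; case: ex_minnP => m _ hm hp; apply: hm.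
have l1 u v : e u v -> lv v <= (lv u).+1.
  move=> euv; have [p [hp hu <-]] := PQ _ _ (lvP u).
  apply: lv_min; rewrite -(size_rcons p v); apply: PP; last by rewrite last_rcons.
  by rewrite rcons_path hp hu.
exists lv; first split=> //.
- move=> u; apply/eqP/eqP => [h|->].
    have [p [_ hu]] := PQ _ _ (lvP u); rewrite h => /size0nil hp.
    by rewrite -hu hp.
  by apply/eqP; rewrite -leqn0 -[0]/(size (Nil T)); apply: lv_min; apply: PP.
- move=> u i h; have [p [hp hu sp]] := PQ _ _ (lvP u).
  case/lastP: p hp hu sp => [|p w]; first by rewrite h.
  rewrite rcons_path last_rcons size_rcons h => /andP[hp ew] wu [sp].
  exists (last x p); first by rewrite -wu.
  have le : lv (last x p) <= i by rewrite -sp; apply: lv_min; apply: PP.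
  by have := l1 _ _ ew; rewrite wu h; lia.
- move=> u; have /connectP[p hp hu] := conn u; case/shortenP: hp hu => q hq uq _ hu.
  apply: (@leq_trans (size (x :: q))); last by rewrite -(card_uniqP uq) max_card.
  by apply: lv_min; apply: PP.
Qed.

Definition covers (w : T) (p : T * T) := (w \in N p.1) || (w \in N p.2).

Definition edge_cover (F : seq (T * T)) :=
  all (fun p => e p.1 p.2) F && [forall w, has (covers w) F].

Section Levels.
Variables (x : T) (lv : T -> nat).
Hypotheses (lvx : level x lv) (adm : admissible x).

Let lv0 := level0 lvx.
Let lv1 := level_edge lvx.

Lemma nbh_level u v : u \in N v -> lv u <= (lv v).+1 /\ lv v <= (lv u).+1.
Proof.
by rewrite in_nbh => /predU1P[->|h]; [lia | split; apply: lv1; rewrite // es].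
Qed.

Definition down w := [set u | e u w && (lv w == (lv u).+1)].

Lemma down_ex w : 0 < lv w -> exists u, u \in down w.
Proof.
move=> w0; have [|u eu lu] := @level_pred _ _ lvx w (lv w).-1; first lia.
by exists u; rewrite inE eu lu; apply/eqP; lia.
Qed.

(** A path descending by levels from [y] stays at least two levels below [v], out of reach of
    [N v]. *)
Lemma reach_far v y : (lv y).+1 < lv v -> reach (N v) y x.
Proof.
have [i] := ubnP (lv y); elim: i => // i ih in y * => hi hy.
have yN : y \notin N v by apply/negP => /nbh_level[_]; lia.
have [y0|] := posnP (lv y).
  by move/eqP: y0; rewrite lv0 => /eqP <-; rewrite /reach yN connect0.
move=> /down_ex[u]; rewrite inE => /andP[eu /eqP lu].
have ey : e y u by rewrite es.
by apply: reach_cons yN ey (ih u _ _); lia.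
Qed.

(** On a descending path from [w] only the first two vertices can be within one level of [v]; from
    the third on [reach_far] applies. *)
Lemma reach_down v w w' : w \notin N v -> w' \notin N v -> w' \in down w ->
  lv w <= lv v -> reach (N v) w x.
Proof.
move=> wN wN'; rewrite inE => /andP[ew /eqP lw] le.
have ew' : e w w' by rewrite es.
apply: reach_cons wN ew' _; have [y0|] := posnP (lv w').
  by move/eqP: y0; rewrite lv0 => /eqP <-; rewrite /reach wN' connect0.
move=> /down_ex[u]; rewrite inE => /andP[eu /eqP lu].
have eu' : e w' u by rewrite es.
by apply: reach_cons wN' eu' (reach_far _); lia.
Qed.

(** If each vertex had a lower neighbour that the other lacks, both could descend to [x] avoiding
    the other's neighbourhood and would be unrelated. *)
Lemma down_comparable v w : lv w = lv v -> w \notin N v ->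
  (down w \subset down v) || (down v \subset down w).
Proof.
move=> lwv wN; apply/orP; case: (boolP (down w \subset down v)); first by left.
move=> /subsetPn[w' hw' nw']; right; apply/subsetP => v' hv'; apply/negPn/negP => nv'.
have vN : v \notin N w by rewrite nbh_sym.
have aux a b a' : lv a = lv b -> a' \in down a -> a' \notin down b -> a' \notin N b.
  move=> lab; rewrite !inE lab => /andP[_ /eqP lb]; rewrite lb eqxx andbT => h.
  by apply/norP; split; [apply/eqP => ab; move: lb; rewrite ab; lia | rewrite es].
have wN' := aux w v w' lwv hw' nw'; have vN' := aux v w v' (esym lwv) hv' nv'.
by have := adm w v; rewrite /unrelated (reach_down wN wN' hw') ?(reach_down vN vN' hv') ?lwv.
Qed.

(** Otherwise [v] descends through [v'] and [v''] avoiding [N w]. The lower neighbours of [w] are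
    two levels below [v], so [w] descends avoiding [N v], and the two are unrelated. *)
Lemma down_step w v v' v'' : lv v = (lv w).+1 -> v \notin N w ->
  v' \in down v -> v' \notin N w -> v'' \in down v' -> v'' \in N w.
Proof.
move=> lvw vN hv' vN' hv''; apply/negPn/negP => vN''.
have wN : w \notin N v by rewrite nbh_sym.
move: (hv') (hv''); rewrite !inE => /andP[ev' /eqP lv'] /andP[ev'' /eqP lv''].
have evv' : e v v' by rewrite es.
have rv : reach (N w) v x.
  by apply: reach_cons vN evv' (reach_down vN' vN'' hv'' _); lia.
have /down_ex[w'] : 0 < lv w by lia.
rewrite inE => /andP[ew /eqP lw]; have eww' : e w w' by rewrite es.
have rw : reach (N v) w x by apply: reach_cons wN eww' (reach_far _); lia.
by have := adm v w; rewrite /unrelated rv rw.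
Qed.


Let d := \max_u lv u.

Lemma level_le_max u : lv u <= d.
Proof. exact: leq_bigmax. Qed.

(* Choosing each predecessor with as few lower neighbours as possible makes the
   path dominate every level from the same level and the one before. *)
Lemma spine_exists : exists xs : nat -> T,
  [/\ forall i, i <= d -> lv (xs i) = i,
      forall i, i < d -> e (xs i) (xs i.+1)
    & forall w, (w \in N (xs (lv w))) || (0 < lv w) && (w \in N (xs (lv w).-1))].
Proof.
have [u0 hu0] : exists u0, lv u0 == d.
  have [|u0 _ hu0] := @eq_bigmax_cond T xpredT lv; last by exists u0; rewrite -hu0.
  by apply/card_gt0P; exists x.
(* No vertex lies above level [d], so the minimality that [pr] provides on lower levels is imposed
   directly on the last vertex of the path. *)
have [y /eqP ly miny] := @arg_minnP _ u0 (fun u => lv u == d) (fun u => #|down u|) hu0.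
pose pr v := [arg min_(u < odflt v [pick u in down v] | u \in down v) #|down u|].
have prP v : 0 < lv v -> pr v \in down v /\ forall u, u \in down v -> #|down (pr v)| <= #|down u|.
  move=> /down_ex[u0' hu0']; rewrite /pr; case: arg_minnP; last by [].
  by case: pickP => [//|/(_ u0')]; rewrite hu0'.
pose xs i := iter (d - i) pr y.
have lev j : j <= d -> lv (iter j pr y) = d - j.
  elim: j => [|j ih] jd; first by rewrite subn0.
  have [|hd _] := prP (iter j pr y); first by rewrite ih; lia.
  by move: hd; rewrite inE /= ih => [/andP[_ /eqP]|]; lia.
have lxs i : i <= d -> lv (xs i) = i by move=> id; rewrite lev; lia.
have xsS i : i < d -> xs i = pr (xs i.+1).
  by move=> id; rewrite /xs -iterS; congr (iter _ _ _); lia.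
have dxs i : i < d -> xs i \in down (xs i.+1).
  by move=> id; rewrite xsS //; apply: (prP _ _).1; rewrite lxs.
exists xs; split=> // [i /dxs|w]; first by rewrite inE => /andP[].
have [w0|w0] := posnP (lv w).
  rewrite w0; move/eqP: (w0) (lxs 0 isT) => + /eqP; rewrite !lv0 => /eqP -> /eqP ->.
  by rewrite in_nbh eqxx.
rewrite /=; case: (boolP (w \in N (xs (lv w)))) => //= wN.
have wd := level_le_max w; set i := lv w in w0 wN wd *.
have hd1 : xs i.-1 \in down (xs i) by rewrite -{2}(prednK w0) dxs ?prednK.
have fin : xs i.-1 \in down w -> w \in N (xs i.-1).
  by rewrite inE in_nbh => /andP[-> _]; rewrite orbT.
(* If [w] has fewer lower neighbours than [xs i], it is not adjacent to [xs i.+1], whose choice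
   would have preferred it; then [down_step] makes [xs i.-1] a neighbour of [w]. *)
have nle : ~ #|down (xs i)| <= #|down w| -> w \in N (xs i.-1).
  move=> nle; move: (id wd); rewrite leq_eqVlt => /predU1P[id|id].
    by case: nle; rewrite {1}id /xs subnn; apply: miny; rewrite -id.
  have [vN|vN] := boolP (xs i.+1 \in N w).
    case: nle; rewrite xsS //; apply: (prP _ _).2; rewrite ?lxs //.
    move: vN; rewrite in_nbh inE (lxs _ id) eqxx andbT => /predU1P[h|//].
    by have := lxs _ id; rewrite h -/i; lia.
  rewrite nbh_sym; apply: down_step vN (dxs _ id) _ hd1; first by rewrite lxs.
  by rewrite nbh_sym.
have /orP[s|/subsetP s] := down_comparable (esym (lxs _ wd)) wN; last exact: fin (s _ hd1).
case: (boolP (#|down (xs i)| <= #|down w|)) => [le|/negP]; last exact: nle.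
by apply: fin; have /eqP -> : down w == down (xs i) by rewrite eqEcard s.
Qed.
End Levels.
End ATFree.

(** * Edge covers and pairings *)

Section Covers.
Variables (T : finType) (e : rel T).
Hypotheses (es : symmetric e) (ei : irreflexive e) (iso : no_isolated e).

Local Notation N := (closed_nbh e).
Implicit Types (F : seq (T * T)) (p : T * T) (u v w : T) (D : {set T}).

Lemma edge_coverP F : reflect
  ((forall p, p \in F -> e p.1 p.2) /\ forall w, exists2 p, p \in F & covers e w p)
  (edge_cover e F).
Proof.
apply: (iffP andP) => [[/allP h1 /forallP h2]|[h1 h2]].
  by split=> // w; apply/hasP.
by split; [apply/allP|apply/forallP => w; apply/hasP].
Qed.

Lemma min_cover_exists : exists2 F, edge_cover e F &
  forall F', edge_cover e F' -> size F <= size F'.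
Proof.
pose P k := [exists F : k.-tuple (T * T), edge_cover e F].
have exP : exists k, P k.
  pose F := [seq p <- enum {: T * T} | e p.1 p.2].
  exists (size F); apply/existsP; exists (in_tuple F); apply/edge_coverP; split.
    by move=> p; rewrite mem_filter => /andP[].
  move=> w; have [u euw] := iso w; exists (w, u); first by rewrite mem_filter euw mem_enum.
  by rewrite /covers in_nbh eqxx.
have [k /existsP[F hF] hk] := ex_minnP exP.
exists F => // F' hF'; rewrite size_tuple; apply: hk.
by apply/existsP; exists (in_tuple F').
Qed.

(** * Exchanging cover edges for spine edges *)

Section Window.
Variables (x : T) (lv : T -> nat).
Hypotheses (lvx : level e x lv) (adm : admissible e x).

Definition low p := minn (lv p.1) (lv p.2).
Definition window a p := a <= low p <= a + 3.

Let d := \max_u lv u.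

Lemma window_level a p w : e p.1 p.2 -> window a p -> covers e w p ->
  a <= (lv w).+1 /\ lv w <= a + 5.
Proof.
have lv1 := level_edge lvx; move=> hp hw; have := lv1 _ _ hp.
rewrite es in hp; have := lv1 _ _ hp; move: hw; rewrite /window /low.
by move=> ? ? ? /orP[]/(nbh_level es lvx)[]; lia.
Qed.

Lemma depth_gt0 : 0 < d.
Proof.
have [u exu] := iso x; apply: leq_trans (level_le_max _ u).
by rewrite lt0n (level0 lvx); apply: contraTneq exu => ->; rewrite ei.
Qed.

(* In a minimum cover with as many spine edges as possible no window holds four
   edges: trading them for the four spine edges around the window would
   otherwise increase the number of spine edges or decrease the size, and four
   consecutive spine edges are redundant. *)
Lemma good_cover : exists F,
  [/\ edge_cover e F, forall F', edge_cover e F' -> size F <= size F'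
    & forall a, count (window a) F <= 3].
Proof.
have [xs [lxs exs dom]] := spine_exists es lvx adm.
pose pp j := (xs j, xs j.+1).
pose P := [seq pp j | j <- iota 0 d].
have inP j : j < d -> pp j \in P.
  by move=> jd; apply: map_f; rewrite mem_iota.
have [F0 cF0 minF0] := min_cover_exists.
pose k := size F0.
have [|[F /= /eqP sF] cF maxF] := @arg_maxnP _ (in_tuple F0)
  (fun G : k.-tuple (T * T) => edge_cover e G) (fun G => count (mem P) G); first by [].
exists F; rewrite sF; split=> // a; rewrite leqNgt; apply/negP => big.
have [eF covF] := edge_coverP _ cF.
pose R := [seq p <- F | ~~ window a p].
pose W := [seq p <- F | window a p].
have sRW : size R + size W = k.
  by rewrite addnC !size_filter count_predC.
have sW : 3 < size W by rewrite size_filter.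
(* These edges contain the spine vertices of levels a-2 to a+5. Truncated subtraction and [minn] cut
   the range off at the two ends of the spine. *)
pose Q := [seq pp (minn j d.-1) | j <- [:: a - 2; a; a + 2; a + 4]].
have QP : all (mem P) Q.
  have d0 := depth_gt0.
  by apply/allP => p /mapP[j _ ->]; apply: inP; lia.
have eP p : p \in P -> e p.1 p.2.
  by case/mapP => j; rewrite mem_iota => /= jd ->; apply: exs; lia.
have spineQ l : l <= d -> a <= l + 2 -> l <= a + 5 ->
    exists2 q, q \in Q & (xs l == q.1) || (xs l == q.2).
  move=> ld al la; have d0 := depth_gt0.
  have [j jQ hj] : exists2 j, j \in [:: a - 2; a; a + 2; a + 4] &
      l = minn j d.-1 \/ l = (minn j d.-1).+1.
    case: (leqP l (a - 2).+1) => h1; first by exists (a - 2); rewrite ?inE ?eqxx //; lia.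
    case: (leqP l a.+1) => h2; first by exists a; rewrite ?inE ?eqxx ?orbT //; lia.
    case: (leqP l (a + 3)) => h3; first by exists (a + 2); rewrite ?inE ?eqxx ?orbT //; lia.
    by exists (a + 4); rewrite ?inE ?eqxx ?orbT //; lia.
  exists (pp (minn j d.-1)); first exact: (map_f (fun j => pp (minn j d.-1))).
  by case: hj => ->; rewrite eqxx ?orbT.
have cF' : edge_cover e (R ++ Q).
  apply/edge_coverP; split=> [p|w].
    rewrite mem_cat mem_filter => /orP[/andP[_]|/(allP QP)]; [exact: eF|exact: eP].
  have [p pF pw] := covF w.
  case: (boolP (window a p)) => [wp|wp]; last first.
    by exists p; rewrite // mem_cat mem_filter wp pF.
  have [l1 l2] := window_level (eF p pF) wp pw.
  have fromQ l : l <= d -> a <= l + 2 -> l <= a + 5 -> w \in N (xs l) ->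
      exists2 q, q \in R ++ Q & covers e w q.
    move=> h1 h2 h3 wl; have [q qQ hq] := spineQ l h1 h2 h3.
    exists q; first by rewrite mem_cat qQ orbT.
    by rewrite /covers; case/orP: hq => /eqP <-; rewrite wl ?orbT.
  have wd := level_le_max lv w; rewrite -/d in wd.
  by case/orP: (dom w) => [|/andP[w0]]; apply: fromQ; lia.
have sQ : size (R ++ Q) = size R + 4 by rewrite size_cat.
have minF' := minF0 _ cF'; rewrite sQ in minF'.
have sW4 : size W = 4 by lia.
have sRQ : size (R ++ Q) == k by rewrite sQ; apply/eqP; lia.
have le := maxF (Tuple sRQ) cF'.
have cntF : count (mem P) F = count (mem P) R + count (mem P) W.
  by rewrite -count_cat; apply/permP; rewrite perm_sym perm_catC perm_filterC.
(* [R ++ Q] is again a minimum cover, with four spine edges in place of [W]; the maximality of [F]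
   leaves no edge of [W] off the spine. *)
have cntW : count (mem P) W = 4.
  have := count_size (mem P) W; move: le; rewrite /geq /= cntF count_cat.
  by move: (QP); rewrite all_count => /eqP ->; rewrite sW4 /=; lia.
have WP : all (mem P) W by rewrite all_count cntW sW4.
have uF : uniq F.
  rewrite -[uniq F]negbK; apply/negP; rewrite -ltn_size_undup => lt.
  have /minF0 : edge_cover e (undup F); last by rewrite -sF leqNgt lt.
  apply/edge_coverP; split=> [p|w]; first by rewrite mem_undup; apply: eF.
  by have [p pF pw] := covF w; exists p; rewrite ?mem_undup.
(* Only four spine edges have their lower end in the window, so the four distinct members of [W] are
   exactly these. *)
have subW : {subset W <= [seq pp j | j <- iota a 4]}.
  move=> p pW; have /mapP[j] := allP WP p pW; rewrite mem_iota => /andP[_ jd] pj.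
  have lj : lv (xs j) = j by apply: lxs; lia.
  have lj1 : lv (xs j.+1) = j.+1 by apply: lxs; lia.
  have /andP[h _] : (a <= minn j j.+1 <= a + 3) && (p \in F).
    by move: pW; rewrite mem_filter /window /low pj /= lj lj1.
  by rewrite pj; apply: map_f; rewrite mem_iota; lia.
have [|_ eqm] := uniq_min_size (filter_uniq _ uF) subW.
  by rewrite size_map size_iota -/W sW4.
have inF j : a <= j < a + 4 -> pp j \in F.
  move=> hj; suff : pp j \in W by rewrite mem_filter => /andP[].
  by rewrite eqm; apply: map_f; rewrite mem_iota.
have upp : uniq [seq pp j | j <- iota a 4].
  by rewrite -(eq_uniq _ eqm) ?filter_uniq // sW4.
have mrem := mem_rem_uniq (pp a.+1) uF.
(* The ends of [pp a.+1] are also ends of [pp a] and [pp a.+2], so deleting it leaves a smaller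
   cover. *)
have /minF0 : edge_cover e (rem (pp a.+1) F).
  have na : pp a \in rem (pp a.+1) F.
    rewrite mrem !inE inF ?andbT; last lia.
    by apply/eqP => h; move: upp; rewrite /= h !inE eqxx.
  have na2 : pp a.+2 \in rem (pp a.+1) F.
    rewrite mrem !inE inF ?andbT; last lia.
    by apply/eqP => h; move: upp; rewrite /= h !inE eqxx /= andbF.
  apply/edge_coverP; split=> [p /mem_rem|w]; first exact: eF.
  have [p pF] := covF w; have [->|np] := eqVneq p (pp a.+1).
    case/orP => wN; [exists (pp a) => //|exists (pp a.+2) => //]; by rewrite /covers wN ?orbT.
  by exists p => //; rewrite mrem !inE np.
rewrite size_rem; last by apply: inF; lia.
by rewrite sF; move: sRW; rewrite sW4 /k; lia.
Qed.
End Window.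

(** * Paired dominating sets versus edge covers *)

Definition dominated (D : {set T}) w := [exists y in D, w \in N y].

Lemma paired_edge_cover D : paired_dominating e D ->
  exists2 F, edge_cover e F & #|D| = 2 * size F.
Proof.
move=> [domD [M [/subsetP subM trivM covM]]].
pose ends (B : {set T}) := [pick p : T * T | e p.1 p.2 && (B == [set p.1; p.2])].
have endsP B : B \in M -> exists p, [/\ ends B = Some p, e p.1 p.2 & B = [set p.1; p.2]].
  move=> /subM; rewrite inE => /andP[/imsetP[p pe Bp] _]; rewrite inE in pe.
  rewrite /ends; case: pickP => [q /andP[qe /eqP Bq]|/(_ p)]; last by rewrite pe Bp eqxx.
  by exists q.
exists (pmap ends (enum M)).
  apply/edge_coverP; split=> [p|w].
    rewrite mem_pmap => /mapP[B]; rewrite mem_enum => /endsP[q [-> qe _]].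
    by case=> ->.
  have [y yD wy] : exists2 y, y \in D & w \in N y.
    have [wD|/domD[y yD ewy]] := boolP (w \in D); first by exists w; rewrite ?in_nbh ?eqxx.
    by exists y; rewrite // in_nbh es ewy orbT.
  move: yD; rewrite -covM => /bigcupP[B BM yB]; have [p [hB pe Bp]] := endsP B BM.
  exists p; first by rewrite mem_pmap -hB map_f // mem_enum.
  by move: yB; rewrite Bp !inE /covers => /orP[]/eqP <-; rewrite wy ?orbT.
rewrite -covM -(eqP trivM) (eq_bigr (fun=> 2)) => [|B /endsP[p [_ pe ->]]]; last first.
  by rewrite cards2; case: eqP pe => // ->; rewrite ei.
rewrite sum_nat_const mulnC; congr (2 * _); rewrite cardE size_pmap.
apply/esym/eqP; rewrite -all_count.
by apply/allP => B; rewrite mem_enum => /endsP[p [/= -> _ _]].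
Qed.

(** [D] is tied to [F] only through its size and the vertices it dominates, not through the ends of
    [F]; this allows an end to be replaced or left out. *)
Definition pairing F (D : {set T}) :=
  [/\ exists M, perfect_matching_on e D M, #|D| <= 2 * size F
    & forall w, has (covers e w) F -> dominated D w].

Lemma pairing_nil : pairing [::] set0.
Proof.
split=> //; last by rewrite cards0.
exists set0; split; first exact: sub0set.
  by apply/trivIsetP => A B; rewrite inE.
by rewrite /cover big_set0.
Qed.

Lemma dominated_sub (D D' : {set T}) w : D \subset D' -> dominated D w -> dominated D' w.
Proof.
move=> /subsetP s /existsP[y /andP[yD wy]]; apply/existsP; exists y.
by rewrite s.
Qed.

Lemma pairing_skip F D p : pairing F D ->
  (forall w, covers e w p -> dominated D w) -> pairing (p :: F) D.
Proof.
move=> [hM hc hd] hp; split=> //=; first by rewrite mulnS; apply: leq_trans hc (leq_addl _ _).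
by move=> w /orP[/hp//|/hd].
Qed.

Lemma pairing_pair F D p u v : pairing F D -> e u v -> u \notin D -> v \notin D ->
  (forall w, covers e w p -> dominated (u |: (v |: D)) w) ->
  pairing (p :: F) (u |: (v |: D)).
Proof.
move=> [[M [/subsetP subM trivM covM]] hc hd] euv uD vD hp.
have uv : u != v by apply: contraTneq euv => ->; rewrite ei.
have sD : D \subset u |: (v |: D) by rewrite setUA subsetUr.
split=> /=.
- exists ([set u; v] |: M); split.
  + apply/subsetP => B; rewrite in_setU1 inE => /predU1P[->|/subM].
      rewrite setUA subsetUl andbT; apply/imsetP; exists (u, v) => //; by rewrite inE.
    by rewrite inE => /andP[-> BD]; apply: subset_trans BD sD.
  + have disj B : B \in M -> [disjoint [set u; v] & B].
      move=> /subM; rewrite inE => /andP[_ /subsetP BD].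
      by rewrite disjoints_subset; apply/subsetP => z; rewrite !inE => /orP[]/eqP ->;
        apply/negP => /BD; apply/negP.
    have M0 : set0 \notin M.
      apply/negP => /subM; rewrite inE => /andP[/imsetP[q _ q0] _].
      by have := set21 q.1 q.2; rewrite -q0 in_set0.
    by have [] := trivIsetU1 disj trivM M0.
  + by rewrite /cover bigcup_setU big_set1 setUA; congr (_ :|: _).
- rewrite !cardsU1 in_setU1 negb_or uv uD vD mulnS; lia.
- move=> w /orP[/hp//|/hd]; exact: dominated_sub.
Qed.

(* The end [y] of the edge is matched with a free neighbour; if it has none, it
   can be left out, because its closed neighbourhood is already dominated. *)
Lemma pairing_step F D u v (y := if u \in D then v else u) :
  pairing F D -> e u v ->
  [/\ y \in D -> pairing ((u, v) :: F) D,
      y \notin D -> (forall z, e y z -> z \in D) -> pairing ((u, v) :: F) D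
    & forall g, y \notin D -> g \notin D -> e y g -> (u \notin D -> v \notin D -> g = v) ->
        pairing ((u, v) :: F) (y |: (g |: D))].
Proof.
move=> hp euv; have evu : e v u by rewrite es.
have indom (D' : {set T}) z w : z \in D' -> w \in N z -> dominated D' w.
  by move=> zD wz; apply/existsP; exists z; rewrite zD.
rewrite /y; case: (boolP (u \in D)) => uD; split=> //.
- by move=> vD; apply: pairing_skip => // w /orP[]; apply: indom.
- move=> vD hv; apply: pairing_skip => // w /orP[]; first exact: indom.
  rewrite in_nbh => /predU1P[->|/hv wD]; first by apply: indom uD _; rewrite in_nbh euv orbT.
  by apply: indom wD _; rewrite in_nbh eqxx.
- move=> g vD gD evg _; apply: pairing_pair => // w /orP[]; apply: indom.
    by rewrite !inE uD !orbT.
  by rewrite !inE eqxx.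
- by move=> uD'; rewrite uD' in uD.
- move=> _ hu; apply: pairing_skip => // w /orP[]; last by apply: indom; apply: hu.
  have vD := hu _ euv.
  rewrite in_nbh => /predU1P[->|/hu wD]; first by apply: indom vD _; rewrite in_nbh evu orbT.
  by apply: indom wD _; rewrite in_nbh eqxx.
(* With both ends free the partner has to be [v] itself, because nothing else is known to dominate
   the neighbourhood of the second end. *)
- move=> g _ gD eug hg; apply: pairing_pair => // w /orP[]; apply: indom.
    by rewrite !inE eqxx.
  by have [vD|/hg ->] := boolP (v \in D); rewrite ?in_setU1 ?vD ?eqxx ?orbT.
Qed.

(** By [paired_edge_cover] a competitor has exactly twice as many vertices as some edge cover has
    edges, and that cover is not smaller than [F]. *)
Lemma pairing_minimum F D : edge_cover e F ->
  (forall F', edge_cover e F' -> size F <= size F') -> pairing F D ->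
  minimum_paired_dominating e D.
Proof.
move=> cF minF [hM hc hd]; split.
  split=> // w wD; have /andP[_ /forallP/(_ w)/hd/existsP[y /andP[yD]]] := cF.
  by rewrite in_nbh => /predU1P[wy|ey]; [rewrite wy yD in wD | exists y; rewrite // es].
move=> D' /paired_edge_cover[F' cF' ->]; apply: leq_trans hc _.
by rewrite leq_mul2l minF.
Qed.
End Covers.

(** * Sorting a cover along the levels *)

Lemma sorted_nth_count s t i : sorted leq s -> i < size s ->
  (nth 0 s i <= t) = (i < count (fun y => y <= t) s).
Proof.
elim: s i => [//|a s ih] [|i] /= ps si; have ss := path_sorted ps.
  case: (leqP a t) => at'; first by [].
  apply/esym/negbTE; rewrite -leqNgt leqn0 -[_ == 0]negbK -lt0n -has_count.
  apply/hasP => -[b /(allP (order_path_min leq_trans ps)) ab bt]; lia.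
rewrite ih //; case: (leqP a t) => at'; first by [].
have -> : count (fun y => y <= t) s = 0; last by [].
apply/eqP; rewrite -[_ == 0]negbK -lt0n -has_count.
by apply/hasP => -[b /(allP (order_path_min leq_trans ps)) ab bt]; lia.
Qed.

Section Schedule.
Variables (T : finType) (e : rel T) (x : T) (lv : T -> nat).
Hypotheses (es : symmetric e) (lvx : level e x lv).
Variable F : seq (T * T).
Hypotheses (cF : edge_cover e F) (wF : forall a, count (window lv a) F <= 3).
Variables (m : nat) (o : nat -> T).
Hypotheses (osort : forall c c', c <= c' -> c' < m -> lv (o c) <= lv (o c'))
  (osurj : forall v, exists2 c, c < m & o c = v).

(* Sorting the cover by lower level, the edges among the first [j c.+1] that
   reach the level of [o c] are among the last three. *)
Lemma schedule_exists : exists2 s, perm_eq s F & exists2 j : nat -> nat, j 0 = 0 &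
  forall c, c < m -> [/\ j c <= j c.+1 <= j c + 3, j c.+1 <= size s &
    exists i, i < j c.+1 <= i + 3 /\ covers e (o c) (nth (x, x) s i)].
Proof.
pose s := sort (relpre (low lv) leq) F.
have ps : perm_eq s F by rewrite perm_sort.
have ss : sorted leq (map (low lv) s).
  by rewrite sorted_map sort_sorted // => p q; apply: leq_total.
pose cnt t := count (fun p => low lv p <= t) s.
have cntE t : count (fun y => y <= t) (map (low lv) s) = cnt t by rewrite count_map.
have win a : count (window lv a) s <= 3 by rewrite (permP ps).
have cnt_mono t t' : t <= t' -> cnt t <= cnt t'.
  by move=> tt; apply: sub_count => p /= h; apply: leq_trans h tt.
have cnt3 t : cnt t.+1 <= cnt t + 3.
  apply: leq_trans (leq_add (leqnn _) (win t.+1)).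
  rewrite -count_predUI; apply: leq_trans (leq_addr _ _).
  by apply: sub_count => p /=; rewrite /window; lia.
(* An edge that covers a vertex of level l has its lower end at level at most l + 1, so [j c.+1]
   counts the sorted edges up to that level. *)
exists s => //; exists (fun c => if c is c'.+1 then cnt (lv (o c')).+1 else 0) => // c cm.
split; last 1 first.
- have /andP[_ /forallP/(_ (o c))] := cF; rewrite -(perm_has _ ps) => /(has_nthP (x, x)).
  case=> i si ci; exists i; split=> //; set p := nth _ s i in ci *.
  have pF : p \in F by rewrite -(perm_mem ps) mem_nth.
  have ep : e p.1 p.2 by have /andP[/allP/(_ p pF)] := cF.
  have [h1 h2] : low lv p <= (lv (o c)).+1 /\ lv (o c) <= low lv p + 2.
    have := level_edge lvx ep; have := level_edge lvx (_ : e p.2 p.1).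
    by rewrite es => /(_ ep); rewrite /low; move: ci => /orP[]/(nbh_level es lvx)[]; lia.
  have lt : i < cnt (lv (o c)).+1.
    by rewrite -cntE -sorted_nth_count // ?size_map // (nth_map (x, x)).
  rewrite lt leqNgt; apply/negP => big.
  set t := (lv (o c)).+1 in h1 lt big.
  have st : cnt t <= size s by apply: count_size.
  (* An edge covering [o c] has its lower end at level at least [t - 3]. The edges from position [i]
     up to [cnt t] thus lie in one window, and there are at most three. *)
  pose mid := drop i (take (cnt t) s).
  have sm : size mid = cnt t - i by rewrite size_drop size_takel.
  have am : all (window lv (low lv p)) mid.
    apply/(all_nthP (x, x)) => k; rewrite sm => hk; rewrite nth_drop nth_take; last lia.
    have k1 : i + k < size s by lia.
    have : low lv (nth (x, x) s (i + k)) <= t.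
      have := sorted_nth_count t ss (i := i + k); rewrite size_map => /(_ k1).
      by rewrite (nth_map (x, x)) // cntE => ->; lia.
    have : low lv p <= low lv (nth (x, x) s (i + k)).
      have := @sorted_leq_nth _ leq leq_trans leqnn 0 _ ss i (i + k).
      by rewrite !inE !size_map !(nth_map (x, x)) // => -> //; apply: leq_addr.
    by rewrite /window; lia.
  have := win (low lv p); rewrite -{1}(cat_take_drop (cnt t) s) count_cat.
  rewrite -{1}(cat_take_drop i (take (cnt t) s)) count_cat -/mid.
  by move: am; rewrite all_count => /eqP ->; rewrite sm; lia.
- case: c cm => [|c] cm.
    have lo0 : lv (o 0) = 0.
      have [c0 c0m oc0] := osurj x; have := osort (leq0n c0) c0m.
      by rewrite oc0 => h; apply/eqP; rewrite -leqn0; apply: leq_trans h _;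
        rewrite leqn0 (level0 lvx).
    rewrite lo0; apply/andP; split=> //; apply: leq_trans (win 0).
    by apply: sub_count => p /=; rewrite /window; lia.
  have le : lv (o c) <= lv (o c.+1) by apply: osort.
  (* Levels have no gaps, so consecutive scanned vertices differ by at most one level and [cnt3]
     bounds the increment of [j]. *)
  have le1 : lv (o c.+1) <= (lv (o c)).+1.
    case lo: (lv (o c.+1)) => [|l] //.
    have [v _ lvv] := level_pred lvx lo; have [c' c'm oc'] := osurj v.
    have [cc'|cc'] := leqP c' c.
      by have := osort cc' (ltnW cm); rewrite oc' lvv.
    by have := osort cc' c'm; rewrite oc' lvv lo; lia.
  rewrite cnt_mono ?ltnS //=; apply: leq_trans (cnt3 _).
  by apply: cnt_mono; rewrite ltnS.
- exact: count_size.
Qed.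
End Schedule.

(** * A language of counted loops *)

(* [HP d] is n ^ d and [HM a] is a reduced modulo n ^ r; [HW a] reads cell
   a mod n ^ 2 of the adjacency matrix, and [HA t a] entry a of array t.
   [HFor x d c] runs c for x = 0, ..., n ^ d - 1. *)
Inductive hx :=
  | HC of nat
  | HR of nat
  | HP of nat
  | HW of hx
  | HA of nat & hx
  | HO of binop & hx & hx
  | HM of hx.

Inductive hcmd :=
  | HSkip
  | HSet of nat & hx
  | HPut of nat & hx & hx
  | HOut of hx & hx
  | HSeq of hcmd & hcmd
  | HIf of hx & hcmd & hcmd
  | HFor of nat & nat & hcmd.

Record hst := HS { rg : nat -> nat; raw : nat -> nat; ar : nat -> nat -> nat }.

Definition setr (A : hst) x v := HS [eta rg A with x |-> v] (raw A) (ar A).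
Definition seta (A : hst) t i v :=
  HS (rg A) (raw A)
     (fun t' i' => if (t' == t) && (i' == i) then v else ar A t' i').
Definition setw (A : hst) i v := HS (rg A) [eta raw A with i |-> v] (ar A).

(* [r] bounds stored values by n ^ r, [k] bounds words by n ^ k. *)
Section Language.
Variables (r k : nat).

Section Semantics.
Variable n : nat.

Fixpoint hev (A : hst) (a : hx) : nat :=
  match a with
  | HC c => c
  | HR x => rg A x
  | HP d => n ^ d
  | HW a => raw A (hev A a %% n ^ 2)
  | HA t a => ar A t (hev A a)
  | HO o a b => binop_val o (hev A a) (hev A b)
  | HM a => hev A a %% n ^ r
  end.

(** Total, without word bounds or step counts, so that the algorithm is verified as a function on
    states. A loop leaves n ^ d in its variable, as the compiled [While] does. *)
Fixpoint sem (c : hcmd) (A : hst) : hst :=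
  match c with
  | HSkip => A
  | HSet x a => setr A x (hev A a)
  | HPut t a b => seta A t (hev A a) (hev A b)
  | HOut a b => setw A (hev A a %% n ^ 2) (hev A b)
  | HSeq c1 c2 => sem c2 (sem c1 A)
  | HIf a c1 c2 => if hev A a == 0 then sem c2 A else sem c1 A
  | HFor x d c =>
      setr (foldl (fun B i => sem c (setr B x i)) A (iota 0 (n ^ d))) x (n ^ d)
  end.

End Semantics.

Fixpoint power_expr d := if d is d'.+1 then Op OMul (Reg 0) (power_expr d') else Const 1.

(* Array t occupies the cells n ^ 2 + 8 * i + t, above the adjacency matrix. *)
Definition adr t a :=
  Op OAdd (power_expr 2) (Op OAdd (Op OMul (Const 8) a) (Const t)).

Fixpoint compile_expr (a : hx) : expr :=
  match a with
  | HC c => Const c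
  | HR x => Reg x
  | HP d => power_expr d
  | HW a => Defs.Mem (Op OMod (compile_expr a) (power_expr 2))
  | HA t a => Defs.Mem (adr t (compile_expr a))
  | HO o a b => Op o (compile_expr a) (compile_expr b)
  | HM a => Op OMod (compile_expr a) (power_expr r)
  end.

Definition for_cond x d := Op OLt (Reg x) (power_expr d).
Definition incr x := Assign x (Op OAdd (Reg x) (Const 1)).

Fixpoint compile (c : hcmd) : cmd :=
  match c with
  | HSkip => Skip
  | HSet x a => Assign x (compile_expr a)
  | HPut t a b => Store (adr t (compile_expr a)) (compile_expr b)
  | HOut a b => Store (Op OMod (compile_expr a) (power_expr 2)) (compile_expr b)
  | HSeq c1 c2 => Seq (compile c1) (compile c2)
  | HIf a c1 c2 => If (compile_expr a) (compile c1) (compile c2)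
  | HFor x d c =>
      Seq (Assign x (Const 0)) (While (for_cond x d) (Seq (compile c) (incr x)))
  end.

(* [hev n A a < n ^ degree a] whenever all stored values are below n ^ r. *)
Fixpoint degree (a : hx) : nat :=
  match a with
  | HC c => c
  | HP d => d.+1
  | HO OAdd a b => (maxn (degree a) (degree b)).+1
  | HO OMul a b => degree a + degree b
  | HO OEq _ _ | HO OLt _ _ => 1
  | HO _ a _ => degree a
  | _ => r
  end.

Fixpoint fits (a : hx) : bool :=
  match a with
  | HC _ | HR _ | HP _ => degree a <= k
  | HW a => fits a
  | HA t a => [&& t < 8, fits a & degree a + 4 <= k]
  | HO _ b c => [&& fits b, fits c & degree a <= k]
  | HM a => fits a
  end.

Fixpoint written_regs (c : hcmd) : seq nat :=
  match c with
  | HSet x _ => [:: x]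
  | HSeq c1 c2 | HIf _ c1 c2 => written_regs c1 ++ written_regs c2
  | HFor x _ c => x :: written_regs c
  | _ => [::]
  end.

Fixpoint written_arrays (c : hcmd) : seq nat :=
  match c with
  | HPut t _ _ => [:: t]
  | HSeq c1 c2 | HIf _ c1 c2 => written_arrays c1 ++ written_arrays c2
  | HFor _ _ c => written_arrays c
  | _ => [::]
  end.

(** A check on syntax alone, so for a concrete program it is settled by evaluation. Register 0 is
    protected because it holds n, and [d < r] makes the final value n ^ d of a loop variable
    storable. The reductions [HM] in the programs serve this check: they cap the degree of a stored
    sum, and the correctness proofs show that they do not change its value. *)
Fixpoint well_formed (c : hcmd) : bool :=
  match c with
  | HSkip => true
  | HSet x a => [&& x != 0, fits a & degree a <= r]
  | HPut t a b => [&& t < 8, fits a, degree a + 4 <= k, fits b & degree b <= r]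
  | HOut a b => [&& fits a, fits b & degree b <= r]
  | HSeq c1 c2 => well_formed c1 && well_formed c2
  | HIf a c1 c2 => [&& fits a, well_formed c1 & well_formed c2]
  | HFor x d c => [&& x != 0, x \notin written_regs c, d < r & well_formed c]
  end.

(** Both branches of a conditional are charged. In a loop, 5 is the increment (4) plus the round
    itself (1), and 3 is the initial assignment (2) plus the exit (1). *)
Fixpoint time_bound (n : nat) (c : hcmd) : nat :=
  match c with
  | HSkip => 1
  | HSet x a => (cost (compile_expr a)).+1
  | HPut t a b => (cost (adr t (compile_expr a)) + cost (compile_expr b)).+1
  | HOut a b => (cost (Op OMod (compile_expr a) (power_expr 2)) + cost (compile_expr b)).+1
  | HSeq c1 c2 => time_bound n c1 + time_bound n c2
  | HIf a c1 c2 => (cost (compile_expr a) + (time_bound n c1 + time_bound n c2)).+1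
  | HFor x d c =>
      (n ^ d * (cost (for_cond x d) + time_bound n c + 5) + cost (for_cond x d) + 3)
  end.

Fixpoint time_degree (c : hcmd) : nat :=
  match c with
  | HSeq c1 c2 | HIf _ c1 c2 => maxn (time_degree c1) (time_degree c2)
  | HFor _ d c => d + time_degree c
  | _ => 0
  end.

Lemma time_bound_poly c : exists C, forall n, 0 < n -> time_bound n c <= C * n ^ time_degree c.
Proof.
have cst (m : nat) : exists C, forall n, 0 < n -> m <= C * n ^ 0.
  by exists m => n _; rewrite expn0 muln1.
have le_exp n a b : 0 < n -> a <= b -> n ^ a <= n ^ b by move=> *; exact: leq_pexp2l.
have both c1 c2 : (exists C, forall n, 0 < n -> time_bound n c1 <= C * n ^ time_degree c1) ->
    (exists C, forall n, 0 < n -> time_bound n c2 <= C * n ^ time_degree c2) ->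
    exists C, forall n, 0 < n ->
      time_bound n c1 + time_bound n c2 <= C * n ^ maxn (time_degree c1) (time_degree c2).
  move=> [C1 h1] [C2 h2]; exists (C1 + C2) => n n0; rewrite mulnDl.
  apply: leq_add; [apply: leq_trans (h1 n n0) _ | apply: leq_trans (h2 n n0) _];
    by rewrite leq_mul2l le_exp ?orbT ?leq_maxl ?leq_maxr.
elim: c => [|x a|t a b|a b|c1 h1 c2 h2|a c1 h1 c2 h2|x d c h] /=;
  do ?exact: cst; first exact: both.
- have [C hC] := both _ _ h1 h2; exists (C + (cost (compile_expr a)).+1) => n n0.
  have := hC n n0; have : 0 < n ^ maxn (time_degree c1) (time_degree c2) by rewrite expn_gt0 n0.
  move: (_ ^ _) => X X0 h; rewrite mulnDl; have : (cost (compile_expr a)).+1 <= (cost (compile_expr a)).+1 * X.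
    exact: leq_pmulr.
  lia.
- have [C hC] := h; move: (cost _) => q; exists (C + (q + 7) + (q + 5)) => n n0.
  have := hC n n0; have : 0 < n ^ time_degree c by rewrite expn_gt0 n0.
  have : 0 < n ^ d by rewrite expn_gt0 n0.
  rewrite expnD; move: (n ^ d) (n ^ time_degree c) (time_bound n c) => X Y t X0 Y0 ht.
  have h1 : X * t <= X * (C * Y) by rewrite leq_mul2l ht orbT.
  have h2 : X * (q + 7) <= X * ((q + 7) * Y) by rewrite leq_mul2l leq_pmulr ?orbT.
  have h3 : q + 5 <= (q + 5) * (X * Y) by rewrite leq_pmulr // muln_gt0 X0.
  nia.
Qed.

Lemma sem_unwritten_reg n c A x : x \notin written_regs c -> rg (sem n c A) x = rg A x.
Proof.
elim: c A => [|y a|t a b|a b|c1 h1 c2 h2|a c1 h1 c2 h2|y d c h] A //=.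
- by rewrite inE => /negbTE ->.
- by rewrite mem_cat negb_or => /andP[x1 x2]; rewrite h2 ?h1.
- by rewrite mem_cat negb_or => /andP[x1 x2]; case: ifP => _; rewrite ?h2 ?h1.
- rewrite inE negb_or => /andP[/negbTE xy xc]; rewrite xy.
  by elim: (iota _ _) A => //= i s ih A; rewrite ih h //= xy.
Qed.

Lemma sem_unwritten_array n c A t : t \notin written_arrays c -> ar (sem n c A) t =1 ar A t.
Proof.
elim: c A => [|y a|t' a b|a b|c1 h1 c2 h2|a c1 h1 c2 h2|y d c h] A //=.
- by rewrite inE => /negbTE -> i.
- by rewrite mem_cat negb_or => /andP[t1 t2] i; rewrite h2 ?h1.
- by rewrite mem_cat negb_or => /andP[t1 t2] i; case: ifP => _; rewrite ?h2 ?h1.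
- by move=> tc i; elim: (iota _ _) A => //= j s ih A; rewrite ih h.
Qed.

(** * Simulation on the word RAM *)

Section Correctness.
Variable n : nat.
Hypotheses (n1 : 1 < n) (k4 : 4 <= k) (rk : r < k).

Definition bounded (A : hst) :=
  [/\ forall x, rg A x < n ^ r, forall a, raw A a < n ^ r
    & forall t i, ar A t i < n ^ r].

Definition represents (A : hst) (s : state) :=
  [/\ rg A 0 = n, forall x, regs s x = rg A x,
      forall a, a < n ^ 2 -> memory s a = raw A a
    & forall t i, t < 8 -> memory s (n ^ 2 + (8 * i + t)) = ar A t i].

Let n0 : 0 < n. Proof. exact: ltnW. Qed.

Lemma pow_le a b : a <= b -> n ^ a <= n ^ b.
Proof. exact: leq_pexp2l. Qed.

Lemma const_lt c : c < n ^ c.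
Proof. exact: ltn_expl. Qed.

Lemma hev_degree A a : bounded A -> hev n A a < n ^ degree a.
Proof.
move=> [hr hw ha]; elim: a => [c|x|d|a _|t a _|o a iha b ihb|a _] //=.
- exact: const_lt.
- by rewrite ltn_exp2l.
- case: o => /=.
  + rewrite expnS; apply: (@leq_trans (2 * n ^ maxn (degree a) (degree b))); last first.
      by rewrite leq_mul2r n1 orbT.
    rewrite mul2n -addnn -addnS leq_add //; last exact: leq_trans ihb (pow_le (leq_maxr _ _)).
    exact: ltnW (leq_trans iha (pow_le (leq_maxl _ _))).
  + exact: leq_ltn_trans (leq_subr _ _) iha.
  + rewrite expnD; case: (posnP (hev n A b)) => [->|b0].
      by rewrite muln0 muln_gt0 !expn_gt0 n0.
    by apply: ltn_mul.
  + exact: leq_ltn_trans (leq_div _ _) iha.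
  + exact: leq_ltn_trans (leq_mod _ _) iha.
  + by rewrite expn1; apply: leq_ltn_trans (leq_b1 _) n1.
  + by rewrite expn1; apply: leq_ltn_trans (leq_b1 _) n1.
- by rewrite ltn_mod expn_gt0 n0.
Qed.

Lemma word_lt v d : v < n ^ d -> d <= k -> word (n ^ k) v = Some v.
Proof. by move=> hv hd; rewrite /word (leq_trans hv (pow_le hd)). Qed.

Lemma eval_pwx s d : regs s 0 = n -> d < k -> eval (n ^ k) s (power_expr d) = Some (n ^ d).
Proof.
move=> h0; elim: d => [|d ih] hd /=; first by rewrite (@word_lt _ 1) ?expn1 //; lia.
rewrite h0 (@word_lt _ 2) ?ih /=; try lia; last by rewrite -[X in X < _]expn1 ltn_exp2l.
by rewrite (@word_lt _ d.+2) ?expnS // -!expnS ltn_exp2l.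
Qed.

Local Arguments power_expr : simpl never.

Lemma eval_op W s o a b : eval W s (Op o a b) =
  obind (fun u => obind (fun v => word W (binop_val o u v)) (eval W s b)) (eval W s a).
Proof. by []. Qed.

Lemma eval_mem W s a :
  eval W s (Defs.Mem a) = obind (fun i => word W (memory s i)) (eval W s a).
Proof. by []. Qed.

(** For n >= 2 we have 8 <= n ^ 3, so n ^ 2 and 8 * n ^ d are both at most n ^ (d + 3), and their
    sum is at most n ^ (d + 4). This is the [+ 4] in [fits] and [well_formed]. *)
Lemma adr_lt t i d : t < 8 -> i < n ^ d -> n ^ 2 + (8 * i + t) < n ^ (d + 4).
Proof.
move=> ht hi.
have h1 : n ^ (d + 4) = n * (n ^ (d + 3)) by rewrite addnS expnS.
have h2 : n ^ (d + 3) = n * n ^ 2 * n ^ d by rewrite expnD mulnC -expnS.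
have h3 : n ^ 2 = n * n by rewrite expnS expn1.
have h4 : 8 <= n * n ^ 2 by rewrite h3; nia.
have h5 : 8 * n ^ d <= n ^ (d + 3) by rewrite h2 leq_mul2r h4 orbT.
have h6 : n ^ 2 <= n ^ (d + 3) by apply: pow_le; lia.
have h7 : 2 * n ^ (d + 3) <= n ^ (d + 4) by rewrite h1 leq_mul2r n1 orbT.
lia.
Qed.

Lemma eval_adr A s t a : represents A s -> bounded A -> t < 8 -> degree a + 4 <= k ->
  eval (n ^ k) s (compile_expr a) = Some (hev n A a) ->
  eval (n ^ k) s (adr t (compile_expr a)) = Some (n ^ 2 + (8 * hev n A a + t)).
Proof.
move=> [h0 hr _ _] hb ht hd he; rewrite /adr.
have num c d : 0 < d -> c < 2 ^ d -> c < n ^ d.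
  by move=> d0 hc; apply: (leq_trans hc); rewrite leq_exp2r.
have : eval (n ^ k) s (power_expr 2) = Some (n ^ 2) by rewrite eval_pwx ?hr //; lia.
move: (power_expr 2) => p hp /=; have hA := adr_lt ht (hev_degree a hb).
rewrite hp /= (@word_lt 8 4) ?num // he /= (@word_lt t 3) ?num //; last lia.
set v := hev n A a in hA *; have h1 : 8 * v < n ^ (degree a + 4).
  by apply: leq_ltn_trans hA; rewrite addnC -addnA leq_addr.
have h2 : 8 * v + t < n ^ (degree a + 4) by apply: leq_ltn_trans hA; rewrite leq_addl.
by rewrite (word_lt h1 hd) /= (word_lt h2 hd) /= (word_lt hA hd).
Qed.
Lemma eval_ce A s a : represents A s -> bounded A -> fits a ->
  eval (n ^ k) s (compile_expr a) = Some (hev n A a).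
Proof.
move=> hrep hb; have [h0 hr hw ha] := hrep; have [hbr hbw hba] := hb.
have rr : r <= k := ltnW rk.
have hp : eval (n ^ k) s (power_expr 2) = Some (n ^ 2) by rewrite eval_pwx ?hr //; lia.
elim: a => [c|x|d|a iha|t a iha|o a iha b ihb|a iha];
  rewrite [fits _]/= [compile_expr _]/= [hev _ _ _]/=.
- by move=> hc; apply: word_lt hc; apply: const_lt.
- by move=> _; rewrite /= hr (word_lt (hbr x)).
- by move=> hd; rewrite eval_pwx ?hr.
- move=> /iha {}iha; have h2 : hev n A a %% n ^ 2 < n ^ 2 by rewrite ltn_mod expn_gt0 n0.
  by rewrite eval_mem eval_op iha hp /= (word_lt h2) /= ?hw ?(word_lt (hbw _)) //; lia.
- move=> /and3P[ht /iha {}iha hd]; rewrite eval_mem (eval_adr hrep hb ht hd iha) /=.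
  by rewrite ha // (word_lt (hba _ _)).
- move=> /and3P[/iha {}iha /ihb {}ihb hd]; rewrite eval_op iha ihb.
  exact: word_lt (@hev_degree A (HO o a b) hb) hd.
- move=> /iha {}iha; rewrite eval_op iha eval_pwx ?hr //=.
  by apply: (word_lt _ rr); rewrite ltn_mod expn_gt0 n0.
Qed.

Lemma represents_setr A s x v : x != 0 -> represents A s ->
  represents (setr A x v) (State [eta regs s with x |-> v] (memory s)).
Proof.
move=> x0 [h0 hr hw ha]; split=> //= [|y]; last by rewrite hr.
by rewrite eq_sym (negbTE x0).
Qed.

Lemma bounded_setr A x v : v < n ^ r -> bounded A -> bounded (setr A x v).
Proof. by move=> hv [hr hw ha]; split=> //= y; case: eqP. Qed.

Lemma sem_exec c A s : well_formed c -> represents A s -> bounded A ->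
  exists t s', [/\ exec (n ^ k) (compile c) s t s', t <= time_bound n c,
                  represents (sem n c A) s' & bounded (sem n c A)].
Proof.
elim: c A s => [|x a|t a b|a b|c1 h1 c2 h2|a c1 h1 c2 h2|x d c h] A s.
- by exists 1, s; split=> //; constructor.
- move=> /= /and3P[x0 fa da] hrep hb; exists (cost (compile_expr a)).+1; eexists.
  split=> //; first exact: exec_assign (eval_ce hrep hb fa).
    exact: represents_setr.
  apply: bounded_setr => //; exact: leq_trans (hev_degree a hb) (pow_le da).
- move=> /= /and5P[ht fa da fb db] hrep hb.
  exists (cost (adr t (compile_expr a)) + cost (compile_expr b)).+1; eexists; split=> //.
  + exact: exec_store (eval_adr hrep hb ht da (eval_ce hrep hb fa)) (eval_ce hrep hb fb).
  + case: hrep => h0 hr hw ha; split=> //= [i hi|t' i ht'].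
      by rewrite ifF ?hw //; apply/eqP; lia.
    rewrite ha //; congr (if _ then _ else _); apply/eqP/andP => [hh|[/eqP -> /eqP ->] //].
    by split; apply/eqP; lia.
  + have hv := leq_trans (hev_degree b hb) (pow_le db).
    by case: hb => hr hw ha; split=> //= t' i; case: ifP.
- move=> /= /and3P[fa fb db] hrep hb; have [h0 hr hw ha] := hrep.
  have hm : hev n A a %% n ^ 2 < n ^ 2 by rewrite ltn_mod expn_gt0 n0.
  have he : eval (n ^ k) s (Op OMod (compile_expr a) (power_expr 2)) = Some (hev n A a %% n ^ 2).
    by rewrite eval_op (eval_ce hrep hb fa) eval_pwx ?hr //= ?(word_lt hm) //; lia.
  exists (cost (Op OMod (compile_expr a) (power_expr 2)) + cost (compile_expr b)).+1; eexists; split=> //.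
  + exact: exec_store he (eval_ce hrep hb fb).
  + split=> //= [i hi|t' i ht']; first by rewrite hw.
    by rewrite ifF ?ha //; apply/eqP; lia.
  + have hv := leq_trans (hev_degree b hb) (pow_le db).
    by case: hb => ? ? ?; split=> //= i; case: ifP.
- move=> /= /andP[w1 w2] hrep hb.
  have [t1 [s1 [e1 l1 r1 b1]]] := h1 _ _ w1 hrep hb.
  have [t2 [s2 [e2 l2 r2 b2]]] := h2 _ _ w2 r1 b1.
  exists (t1 + t2), s2; split=> //; first exact: exec_seq e1 e2.
  exact: leq_add.
- move=> /= /and3P[fa w1 w2] hrep hb; have he := eval_ce hrep hb fa.
  case: ifP => v0.
    have [t [s' [e' l' r' b']]] := h2 _ _ w2 hrep hb.
    exists (cost (compile_expr a) + t).+1, s'; split=> //; last by rewrite ltnS leq_add2l; lia.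
    by apply: (exec_if (v := hev n A a)) => //; rewrite v0.
  have [t [s' [e' l' r' b']]] := h1 _ _ w1 hrep hb.
  exists (cost (compile_expr a) + t).+1, s'; split=> //; last by rewrite ltnS leq_add2l; lia.
  by apply: (exec_if (v := hev n A a)) => //; rewrite v0.
- move=> /= /and4P[x0 xc dr wc] hrep hb.
  pose body B i := sem n c (setr B x i); pose N := n ^ d.
  have Nr : N < n ^ r by rewrite ltn_exp2l.
  pose q := cost (for_cond x d).
  have cond B i s1 : i <= N -> represents (setr B x i) s1 -> bounded (setr B x i) ->
      eval (n ^ k) s1 (for_cond x d) = Some (i < N : nat).
    move=> iN [h0 hr _ _] hb1; rewrite eval_op /= hr /= eqxx (word_lt (leq_ltn_trans iN Nr)) ?(ltnW rk) //=.
    rewrite eval_pwx ?hr //=; last lia.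
    apply: (@word_lt _ 1); last lia.
    by rewrite expn1; apply: leq_ltn_trans (leq_b1 _) n1.
  (* Stated for any starting index [i] with [j] rounds left, so that the induction follows
     [iota i j]. *)
  have loop j : forall i B s1, i + j = N -> represents (setr B x i) s1 -> bounded (setr B x i) ->
      exists t s', [/\ exec (n ^ k) (While (for_cond x d) (Seq (compile c) (incr x))) s1 t s',
        t <= j * (q + time_bound n c + 5) + q + 1,
        represents (setr (foldl body B (iota i j)) x N) s'
      & bounded (setr (foldl body B (iota i j)) x N)].
    elim: j => [|j ih] i B s1 hij hr1 hb1.
      rewrite addn0 in hij; subst i.
      exists q.+1, s1; split=> //; last by rewrite mul0n add0n addn1.
      by apply: exec_while_stop; rewrite (cond B N) ?ltnn.
    have iN : i < N by lia.
    have hc := cond B i s1 (ltnW iN) hr1 hb1; rewrite iN in hc; have [t1 [s2 [e1 l1 r1 b1]]] := h _ _ wc hr1 hb1.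
    have hx : regs s2 x = i by case: (r1) => _ -> _ _; rewrite sem_unwritten_reg //= eqxx.
    have iNr : i.+1 < n ^ r by apply: leq_ltn_trans Nr.
    have e2 : exec (n ^ k) (incr x) s2 4 (State [eta regs s2 with x |-> i.+1] (memory s2)).
      apply: (@exec_assign _ s2 x (Op OAdd (Reg x) (Const 1))).
      rewrite /= hx (word_lt (ltnW iNr) (ltnW rk)) (@word_lt 1 1) ?expn1 //=; last lia.
      by rewrite addn1 (word_lt iNr (ltnW rk)).
    have r2 : represents (setr (body B i) x i.+1) _ := represents_setr i.+1 x0 r1.
    have [||t3 [s3 [e3 l3 r3' b3]]] := ih i.+1 (body B i) _ _ r2; first lia.
      exact: bounded_setr.
    exists (q + (t1 + 4) + t3).+1, s3; split=> //.
      exact: exec_while_loop hc _ (exec_seq e1 e2) e3.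
    rewrite mulSn; lia.
  have [|||t [s' [e' l' r' b']]] := loop N 0 A (State [eta regs s with x |-> 0] (memory s)).
  + by [].
  + exact: represents_setr.
  + by apply: bounded_setr => //; rewrite expn_gt0 n0.
  exists (2 + t), s'; split=> //; last first.
    by apply: (@leq_trans (N * (q + time_bound n c + 5) + q + 3)); [lia|exact: leqnn].
  apply: exec_seq e'; apply: (@exec_assign _ s x (Const 0)).
  by rewrite /= /word expn_gt0 n0.
Qed.
End Correctness.
End Language.

(** * The dynamic program *)

Declare Scope hx_scope.
Delimit Scope hx_scope with hx.
Bind Scope hx_scope with hx.
Notation "a + b" := (HO OAdd a b) : hx_scope.
Notation "a * b" := (HO OMul a b) : hx_scope.
Notation "a / b" := (HO ODiv a b) : hx_scope.
Notation "a 'mod' b" := (HO OMod a b) (at level 40) : hx_scope.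
Notation "a == b" := (HO OEq a b) : hx_scope.
Notation "a < b" := (HO OLt a b) : hx_scope.
Notation "c1 ;; c2" := (HSeq c1 c2) (at level 81, right associativity).
Notation "x ::= a" := (HSet x a) (at level 80).

Notation rSrc := 1 (only parsing).
Notation rC := 2 (only parsing).
Notation rW := 3 (only parsing).
Notation rL := 4 (only parsing).
Notation rU := 5 (only parsing).
Notation rF := 6 (only parsing).
Notation rCnt := 7 (only parsing).
Notation rFree := 8 (only parsing).
Notation rBest := 9 (only parsing).
Notation rY := 10 (only parsing).
Notation rA := 11 (only parsing).
Notation rQ := 12 (only parsing).
Notation rM := 13 (only parsing).
Notation rH := 14 (only parsing).
Notation rI := 15 (only parsing).
Notation rP := 16 (only parsing).
Notation rV := 17 (only parsing).
Notation rG := 18 (only parsing).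
Notation rZ := 19 (only parsing).
Notation rE := 20 (only parsing).

Notation aTab := 1 (only parsing).
Notation aLev := 2 (only parsing).
Notation aOrd := 3 (only parsing).
Notation aEdge := 4 (only parsing).
Notation aPrev := 5 (only parsing).
Notation aLen := 6 (only parsing).
Notation aDom := 7 (only parsing).

(* An edge is coded by its cell in the adjacency matrix.  The table is indexed
   by the codes of the last three edges chosen, written in base n ^ 2; its
   entries point to linked lists of all the edges chosen so far. *)
Definition store_node (idx : hx) : hcmd :=
  HPut aEdge (HR rFree) (HR rQ) ;;
  HPut aPrev (HR rFree) (HR rM) ;;
  HPut aLen (HR rFree) (HM (HA aLen (HR rM) + HC 1)) ;;
  HPut aTab idx (HR rFree) ;;
  rFree ::= HM (HR rFree + HC 1).

Definition idx_new : hx := (HR rY * HP 2 + HR rQ)%hx.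
Definition idx_old : hx := (HR rA * HP 4 + HR rY)%hx.

Definition best_prefix : hcmd :=
  rM ::= HC 0 ;;
  HFor rA 2 (HIf (HA aLen (HA aTab idx_old) < HA aLen (HR rM))
    (rM ::= HA aTab idx_old) HSkip).

Definition extend : hcmd :=
  HFor rQ 2 (HIf (HW (HR rQ) *
      (HA aLen (HR rM) + HC 1 < HA aLen (HA aTab idx_new)))
    (store_node idx_new) HSkip).

(* [rY] ranges over the last two codes of the old triple, which are the first
   two codes of the new one. *)
Definition pass : hcmd := HFor rY 4 (best_prefix ;; extend).

Definition covers_x (q : hx) : hx :=
  (HW q * ((q / HP 1 == HR rW) + (q mod HP 1 == HR rW) +
     HW (q / HP 1 * HP 1 + HR rW) + HW (q mod HP 1 * HP 1 + HR rW)))%hx.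

Definition check : hcmd :=
  HFor rH 6 (HIf (covers_x (HR rH mod HP 2) + covers_x ((HR rH / HP 2) mod HP 2)
       + covers_x ((HR rH / HP 4) mod HP 2))
    HSkip (HPut aTab (HR rH) (HC 0))).

(* Three passes, because a minimum cover can be chosen with at most three edges
   of any given lower level. *)
Definition process : hcmd := pass ;; pass ;; pass ;; check.

(* [aLev] holds one plus the distance from the source, and 0 before the visit. *)
Definition find_closer : hcmd :=
  rF ::= (HR rL == HC 0) * (HR rW == HR rSrc) ;;
  HFor rU 1 (HIf ((HA aLev (HR rU) == HR rL) * (HC 0 < HR rL) *
      HW (HR rU * HP 1 + HR rW)) (rF ::= HC 1) HSkip).

Definition bfs : hcmd :=
  HFor rW 1 (HPut aLev (HR rW) (HC 0)) ;;
  rCnt ::= HC 0 ;;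
  HFor rL 1 (HFor rW 1 (HIf (HA aLev (HR rW) == HC 0)
    (find_closer ;;
     HIf (HR rF)
       (HPut aLev (HR rW) (HM (HR rL + HC 1)) ;;
        HPut aOrd (HR rCnt) (HR rW) ;;
        rCnt ::= HM (HR rCnt + HC 1)) HSkip) HSkip)).

Definition dynprog : hcmd :=
  HFor rH 6 (HPut aTab (HR rH) (HC 0)) ;;
  HPut aTab (HC 0) (HC 1) ;;
  HFor rC 1 (rW ::= HA aOrd (HR rC) ;; process).

Definition update_best : hcmd :=
  HFor rH 6 (HIf (HA aLen (HA aTab (HR rH)) < HA aLen (HR rBest))
    (rBest ::= HA aTab (HR rH)) HSkip).

Definition find_cover : hcmd :=
  HPut aLen (HC 0) (HP 12) ;;
  rFree ::= HC 2 ;;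
  HFor rSrc 1 (bfs ;; dynprog ;; update_best).

(** The last conditional overrides the neighbour found by the loop when both ends of the edge are
    free, as [pairing_step] requires. *)
Definition find_partner : hcmd :=
  rF ::= HC 0 ;;
  HFor rZ 1 (HIf (HW (HR rE * HP 1 + HR rZ) * (HA aDom (HR rZ) == HC 0))
     (rF ::= HC 1 ;; rG ::= HR rZ) HSkip) ;;
  HIf ((HR rE == HR rU) * (HA aDom (HR rV) == HC 0)) (rG ::= HR rV) HSkip.

Definition pair_edge : hcmd :=
  rU ::= HA aEdge (HR rP) / HP 1 ;;
  rV ::= HA aEdge (HR rP) mod HP 1 ;;
  HIf (HA aDom (HR rU)) (rE ::= HR rV) (rE ::= HR rU) ;;
  HIf (HA aDom (HR rE)) HSkip
    (find_partner ;;
     HIf (HR rF)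
       (HPut aDom (HR rE) (HC 1) ;; HPut aDom (HR rG) (HC 1)) HSkip) ;;
  rP ::= HA aPrev (HR rP).

(** A minimum edge cover has at most n edges, so n rounds exhaust the list, and rounds on the empty
    list do nothing. The output overwrites the first row of the adjacency matrix, hence comes
    last. *)
Definition pair_cover : hcmd :=
  rP ::= HR rBest ;;
  HFor rI 1 (HIf (HA aLen (HR rP)) pair_edge HSkip) ;;
  HFor rI 1 (HOut (HR rI) (HA aDom (HR rI))).

Definition prog : hcmd := find_cover ;; pair_cover.

(* The value of r: everything stored stays below n ^ 16. *)
Section Loops.
Variable n : nat.
Local Notation run := (sem 16 n).

Lemma sem_for (I : nat -> hst -> Prop) x d c A :
  I 0 A -> (forall i B, i < n ^ d -> I i B -> I i.+1 (run c (setr B x i))) ->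
  exists2 B, I (n ^ d) B & run (HFor x d c) A = setr B x (n ^ d).
Proof.
move=> I0 step; eexists; last by [].
have : forall j i B, i + j = n ^ d -> I i B ->
    I (n ^ d) (foldl (fun B i => run c (setr B x i)) B (iota i j)).
  elim=> [|j ih] i B /= hij hB; first by rewrite -hij addn0.
  by apply: ih; [lia | apply: step => //; lia].
exact.
Qed.

Lemma sem_seq c1 c2 A : run (c1 ;; c2) A = run c2 (run c1 A).
Proof. by []. Qed.

Lemma sem_if a c1 c2 A :
  run (HIf a c1 c2) A = if hev 16 n A a == 0 then run c2 A else run c1 A.
Proof. by []. Qed.

End Loops.

(** * Soundness and optimality of the table *)

Section Run.
Variables (n : nat) (adj : nat -> nat).
Hypotheses (n1 : 1 < n) (adj0 : adj 0 = 0).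

Local Notation run := (sem 16 n).

Definition len (A : hst) h := ar A aLen (ar A aTab h).

Definition valid q := (q < n ^ 2) && (adj q != 0).
Definition cov w q :=
  [|| q %/ n == w, q %% n == w, adj (q %/ n * n + w) != 0
    | adj (q %% n * n + w) != 0].
(** Digit 0 is the most recently chosen edge. *)
Definition dig j h := (h %/ n ^ (2 * j)) %% n ^ 2.

(* Cell 1 is the empty list; cell 0 stands for a missing entry, and has the
   length n ^ 12 that no list attains. *)
Definition lst (A : hst) := fix lst (p : nat) (s : seq nat) : Prop :=
  if s is q :: s' then
    [/\ 1 < p, p < rg A rFree, ar A aEdge p = q, ar A aLen p = size s
      & lst (ar A aPrev p) s']
  else p = 1.

Definition heap A :=
  [/\ raw A =1 adj, 1 < rg A rFree, ar A aLen 0 = n ^ 12 & ar A aLen 1 = 0].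

(** Nodes below the free pointer are immutable, so a stored list stays valid and many table entries
    can share tails. *)
Definition ext (A B : hst) :=
  rg A rFree <= rg B rFree /\
  forall t i, t \in [:: aEdge; aPrev; aLen] -> i < rg A rFree ->
    ar B t i = ar A t i.

(** Soundness of a table entry, with [S] the vertices processed so far. The edges in the index need
    only occur in the list: this is what turns a successful test of a digit in [check] into a fact
    about the list. *)
Definition entry A (S : nat -> Prop) h p := exists s,
  [/\ lst A p s, size s < n ^ 12, all valid s,
      forall j, j < 3 -> adj (dig j h) != 0 -> dig j h \in s
    & forall w, S w -> has (cov w) s].

Definition table A S := forall h, h < n ^ 6 ->
  ar A aTab h = 0 \/ entry A S h (ar A aTab h).

Lemma ext_refl A : ext A A.
Proof. by split. Qed.

Lemma ext_trans A B C : ext A B -> ext B C -> ext A C.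
Proof.
move=> [f1 l1] [f2 l2]; split=> [|t i ht hi]; first exact: leq_trans f2.
by rewrite l2 ?l1 //; apply: leq_trans f1.
Qed.

Lemma lst_ext A B p s : ext A B -> lst A p s -> lst B p s.
Proof.
move=> [fAB hAB]; elim: s p => //= q s ih p [p1 pf he hl hs].
split=> //; [exact: leq_trans fAB|by rewrite hAB|by rewrite hAB|].
by rewrite hAB //; apply: ih.
Qed.

Lemma lst_bound A p s : 1 < rg A rFree -> lst A p s -> 0 < p < rg A rFree.
Proof. by case: s => [|q s] f /=; [move=> ->|case=> p1 pf _ _ _; rewrite pf andbT ltnW]. Qed.

Lemma lst_len A p s : heap A -> lst A p s -> ar A aLen p = size s.
Proof. by move=> [_ _ _ h1]; case: s => [->//|q s] []. Qed.

Lemma entry_ext A B S h p : ext A B -> entry A S h p -> entry B S h p.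
Proof. by move=> hAB [s [h1 h2 h3 h4 h5]]; exists s; split=> //; apply: lst_ext h1. Qed.

Lemma table_bound A S h : heap A -> table A S -> h < n ^ 6 ->
  ar A aTab h < rg A rFree.
Proof.
move=> [_ f _ _] tA /tA[->|[s [hs _ _ _ _]]]; first exact: ltnW.
by have /andP[] := lst_bound f hs.
Qed.

Lemma len_bound A S h : heap A -> table A S -> h < n ^ 6 -> len A h <= n ^ 12.
Proof.
move=> hA tA /tA[h0|[s [hs s12 _ _ _]]]; first by rewrite /len h0; case: hA => _ _ -> _.
by rewrite /len (lst_len hA hs) ltnW.
Qed.

Lemma dig_shift a y q : q < n ^ 2 ->
  [/\ dig 0 (y * n ^ 2 + q) = q,
      dig 1 (y * n ^ 2 + q) = dig 0 (a * n ^ 4 + y)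
    & dig 2 (y * n ^ 2 + q) = dig 1 (a * n ^ 4 + y)].
Proof.
move=> hq; have n20 : 0 < n ^ 2 by rewrite expn_gt0 ltnW.
have e4 : n ^ 4 = n ^ 2 * n ^ 2 by rewrite -expnD.
rewrite /dig !muln0 !muln1 expn0 !divn1 modnMDl modn_small // e4 mulnA modnMDl.
rewrite divnMDl // (divn_small hq) addn0; split=> //.
by rewrite divnMA !divnMDl // (divn_small hq) addn0 modnMDl.
Qed.

Lemma store_nodeP B S a m (q := rg B rQ) (y := rg B rY) :
  heap B -> table B S -> rg B rM = m -> entry B S (a * n ^ 4 + y) m ->
  y < n ^ 4 -> valid q -> (ar B aLen m).+1 < len B (y * n ^ 2 + q) ->
  (rg B rFree).+1 < n ^ 16 ->
  let B' := run (store_node idx_new) B in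
  [/\ heap B', table B' S, ext B B', rg B' rFree = (rg B rFree).+1
    & len B' (y * n ^ 2 + q) = (ar B aLen m).+1 /\
      forall h, h < n ^ 6 -> len B' h <= len B h].
Proof.
move=> hB tB hm en hy vq lt fr16 B'.
have [hraw hfr len0 len1] := hB; have /andP[q2 aq] := vq.
pose h' := y * n ^ 2 + q; pose f := rg B rFree.
have h6 : h' < n ^ 6.
  have -> : n ^ 6 = n ^ 4 * n ^ 2 by rewrite -expnD.
  apply: (@leq_trans (y * n ^ 2 + n ^ 2)); first by rewrite ltn_add2l.
  by rewrite -mulSnr leq_mul2r hy orbT.
(* A node is stored only where it shortens an entry, so every list stays strictly below the sentinel
   length n ^ 12. *)
have le12 := len_bound hB tB h6.
have lt16 : (ar B aLen m).+1 < n ^ 16.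
  by apply: leq_trans lt _; apply: leq_trans le12 _; apply: leq_pexp2l; rewrite // ltnW.
have fr' : rg B' rFree = f.+1 by rewrite /B' /= addn1 modn_small.
have tab' h : ar B' aTab h = if h == h' then f else ar B aTab h by [].
have len' i : ar B' aLen i = if i == f then (ar B aLen m).+1 else ar B aLen i.
  by rewrite /B' /= hm addn1 modn_small.
have eB : ext B B'.
  split; rewrite ?fr' // => t i; rewrite !inE => /or3P[]/eqP -> hi; rewrite ?len' /= ?ltn_eqF //.
have hB' : heap B'.
  split=> //; rewrite ?fr' ?len' ?(ltn_eqF hfr) ?(ltn_eqF (ltnW hfr)) //; exact: ltnW.
have lenh' : len B' h' = (ar B aLen m).+1 by rewrite /len tab' eqxx len' eqxx.
have mono h : h < n ^ 6 -> len B' h <= len B h.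
  move=> hh; have [->|ne] := eqVneq h h'; first by rewrite lenh' ltnW.
  by rewrite /len tab' (negbTE ne) len' ltn_eqF // (table_bound hB tB).
have edge' : ar B' aEdge f = q by rewrite /B' /= eqxx.
have prev' : ar B' aPrev f = m by rewrite /B' /= eqxx hm.
clearbody B'; split=> // h hh; rewrite tab'; case: eqVneq => [->|ne]; last first.
  by have [->|en'] := tB h hh; [left | right; apply: entry_ext en'].
right; have [s [hs s12 vs digs covs]] := en.
have lm := lst_len hB hs.
exists (q :: s); split=> /=.
- split; [by []|by rewrite fr'|by []|by rewrite len' eqxx lm|].
  by rewrite prev'; apply: lst_ext hs.
- by rewrite -lm; apply: leq_trans lt le12.
- by rewrite vq.
- have [d0 d1 d2] := dig_shift a y q2.
  case=> [|[|[|//]]] _; rewrite -/h' ?d0 ?d1 ?d2 inE ?eqxx // => hd;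
    by rewrite digs ?orbT.
- by move=> w /covs ->; rewrite orbT.
Qed.

Definition steps S d A B :=
  [/\ heap B, table B S, ext A B, rg B rFree <= rg A rFree + d
    & forall h, h < n ^ 6 -> len B h <= len A h].

Lemma steps_trans S d1 d2 A B C : steps S d1 A B -> steps S d2 B C ->
  steps S (d1 + d2) A C.
Proof.
move=> [_ _ e1 f1 m1] [hC tC e2 f2 m2]; split=> //; first exact: ext_trans e2.
  by rewrite addnA; apply: leq_trans f2 _; rewrite leq_add2r.
by move=> h hh; apply: leq_trans (m2 h hh) (m1 h hh).
Qed.

Lemma steps_refl S A : heap A -> table A S -> steps S 0 A A.
Proof. by move=> hA tA; split; rewrite ?addn0 //; apply: ext_refl. Qed.

Lemma best_prefixP S A (y := rg A rY) (B := run best_prefix A) (m := rg B rM) :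
  heap A -> table A S -> y < n ^ 4 ->
  [/\ ar B = ar A, raw B = raw A, rg B rFree = rg A rFree, rg B rY = y
    & (m = 0 \/ exists a, entry A S (a * n ^ 4 + y) m) /\
      forall a, a < n ^ 2 -> ar A aLen m <= len A (a * n ^ 4 + y)].
Proof.
move=> hA tA hy; rewrite /m /B {m B} /best_prefix sem_seq.
pose I i B := [/\ ar B = ar A, raw B = raw A, rg B rFree = rg A rFree, rg B rY = y
    & (rg B rM = 0 \/ exists a, entry A S (a * n ^ 4 + y) (rg B rM)) /\
      (ar A aLen (rg B rM) <= n ^ 12 /\
      forall a, a < i -> ar A aLen (rg B rM) <= len A (a * n ^ 4 + y))].
have h6 a : a < n ^ 2 -> a * n ^ 4 + y < n ^ 6.
  move=> an; have -> : n ^ 6 = n ^ 2 * n ^ 4 by rewrite -expnD.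
  apply: (@leq_trans (a * n ^ 4 + n ^ 4)); first by rewrite ltn_add2l.
  by rewrite -mulSnr leq_mul2r an orbT.
have [||B [aB rB fB yB [mB [_ leB]]] ->] := @sem_for n I rA 2
    (HIf (HA aLen (HA aTab idx_old) < HA aLen (HR rM)) (rM ::= HA aTab idx_old) HSkip)
    (run (rM ::= HC 0) A); last by split.
- split=> //=; split; [by left|split=> //]; by case: hA => _ _ ->.
- move=> i B hi [aB rB fB yB [mB [m12 leB]]] /=.
  have [lt|ge] := ltnP (ar B 6 (ar B 1 (i * n ^ 4 + rg B 10))) (ar B 6 (rg B 13)); last first.
    split=> //=; split=> //; split=> // a; rewrite ltnS leq_eqVlt => /predU1P[->|/leB//].
    by move: ge; rewrite aB yB.
  rewrite aB yB in lt; split=> //=; rewrite aB yB; split.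
    by have [h0|en] := tA _ (h6 i hi); [left | right; exists i].
  split; first exact: leq_trans (ltnW lt) m12.
  move=> a; rewrite ltnS leq_eqVlt => /predU1P[->//|/leB h]; exact: leq_trans (ltnW lt) h.
Qed.

Lemma extendP S A (y := rg A rY) (m := rg A rM) (B := run extend A) :
  heap A -> table A S -> y < n ^ 4 -> m = 0 \/ (exists a, entry A S (a * n ^ 4 + y) m) ->
  rg A rFree + n ^ 2 < n ^ 16 ->
  steps S (n ^ 2) A B /\
  forall q, valid q -> len B (y * n ^ 2 + q) <= (ar A aLen m).+1.
Proof.
move=> hA tA hy hm f16; rewrite /B {B} /extend.
pose I i B := [/\ rg B rY = y, rg B rM = m, steps S i A B
  & forall q, q < i -> valid q -> len B (y * n ^ 2 + q) <= (ar A aLen m).+1].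
have idx6 i : i < n ^ 2 -> y * n ^ 2 + i < n ^ 6.
  move=> hi; have -> : n ^ 6 = n ^ 4 * n ^ 2 by rewrite -expnD.
  apply: (@leq_trans (y * n ^ 2 + n ^ 2)); first by rewrite ltn_add2l.
  by rewrite -mulSnr leq_mul2r hy orbT.
have mf : m < rg A rFree.
  case: hA => _ f1 _ _; case: hm => [->|[a [s [hs _ _ _ _]]]]; first exact: ltnW.
  by have /andP[] := lst_bound f1 hs.
have [||B [yB mB sB pB] ->] := @sem_for n I rQ 2 (HIf (HW (HR rQ) *
      (HA aLen (HR rM) + HC 1 < HA aLen (HA aTab idx_new))) (store_node idx_new) HSkip) A;
  last by split=> // q vq; apply: pB => //; case/andP: vq.
- by split=> //; apply: steps_refl.
- move=> i B hi [yB mB sB pB]; have [hB tB eB fB lB] := sB.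
  have lenm : ar B aLen m = ar A aLen m by case: eB => _ ->; rewrite ?inE.
  have skip : valid i = false \/ len B (y * n ^ 2 + i) <= (ar B aLen m).+1 -> I i.+1 (setr B rQ i).
    move=> h; split=> //.
      by split=> //; rewrite addnS; apply: leq_trans fB _.
    move=> q; rewrite ltnS leq_eqVlt => /predU1P[->|/pB//] vi.
    by case: h; rewrite ?vi ?lenm.
  have rB : raw B i = adj i by case: hB.
  rewrite sem_if; set c := hev _ _ _ _.
  have -> : c = adj i * ((ar B aLen m).+1 < len B (y * n ^ 2 + i)).
    by rewrite /c /= modn_small // rB yB mB addn1.
  case: ifP => [c0|/negbT]; last rewrite muln_eq0 negb_or eqb0 negbK => /andP[ai lt].
    apply: skip; move: c0; rewrite muln_eq0 /valid hi => /orP[->|]; first by left.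
    by rewrite eqb0 -leqNgt; right.
  have vi : valid i by rewrite /valid hi.
  (* With [m = 0] the candidate would have length n ^ 12 + 1 and could not beat any entry, so [m] is
     a genuine list here. *)
  have [a en] : exists a, entry B S (a * n ^ 4 + y) m.
    case: hm => [m0|[a en]]; last by exists a; apply: entry_ext en.
    have /(len_bound hB tB) := idx6 i hi.
    by move: lt; rewrite m0; case: hB => _ _ -> _; lia.
  have := @store_nodeP (setr B rQ i) S a m hB tB mB.
  rewrite [rg (setr _ _ _) rY]yB => /(_ en hy vi lt) []; first by rewrite /=; lia.
  set B' := run _ _ => hB' tB' eB' fB' [lB' mB'].
  split=> //.
  - split=> //; first exact: ext_trans eB eB'.
      by rewrite fB' addnS ltnS.
    by move=> h hh; apply: leq_trans (mB' h hh) (lB h hh).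
  - move=> q; rewrite ltnS leq_eqVlt => /predU1P[->|qi vq]; first by rewrite lB' lenm.
    apply: leq_trans (mB' _ _) (pB q qi vq); apply: idx6; case/andP: vq => //.
Qed.

Definition same A B := [/\ ar B = ar A, raw B = raw A & rg B rFree = rg A rFree].

Lemma same_ext A B : same A B -> ext A B.
Proof. by move=> [aB _ fB]; split; rewrite ?aB ?fB. Qed.

Lemma same_heap A B : same A B -> heap A -> heap B.
Proof. by move=> [aB rB fB] [h1 h2 h3 h4]; split; rewrite ?aB ?rB ?fB. Qed.

Lemma same_table A B S : same A B -> table A S -> table B S.
Proof.
move=> sAB tA h /tA; case: (sAB) => -> _ _ [->|en]; [by left|right].
exact: entry_ext (same_ext sAB) en.
Qed.

(** The table is updated in place, so a later [y] may read entries already improved in this pass.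
    This is harmless: lengths never increase, and the bound refers to the table before the pass. *)
Lemma passP S A (B := run pass A) :
  heap A -> table A S -> rg A rFree + n ^ 6 < n ^ 16 ->
  steps S (n ^ 6) A B /\
  forall a y q, a < n ^ 2 -> y < n ^ 4 -> valid q ->
    len B (y * n ^ 2 + q) <= (len A (a * n ^ 4 + y)).+1.
Proof.
move=> hA tA f16; rewrite /B {B}.
have e6 : n ^ 6 = n ^ 4 * n ^ 2 by rewrite -expnD.
have h6 a y : a < n ^ 2 -> y < n ^ 4 -> a * n ^ 4 + y < n ^ 6.
  move=> an yn; rewrite e6; apply: (@leq_trans (a * n ^ 4 + n ^ 4)); first by rewrite ltn_add2l.
  by rewrite -mulSnr mulnC leq_mul2l an orbT.
have idx6 y q : y < n ^ 4 -> q < n ^ 2 -> y * n ^ 2 + q < n ^ 6.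
  move=> yn qn; rewrite e6; apply: (@leq_trans (y * n ^ 2 + n ^ 2)); first by rewrite ltn_add2l.
  by rewrite -mulSnr leq_mul2r yn orbT.
pose I i B := steps S (i * n ^ 2) A B /\ forall a y q, a < n ^ 2 -> y < i -> valid q ->
    len B (y * n ^ 2 + q) <= (len A (a * n ^ 4 + y)).+1.
have [||B [sB pB] ->] := @sem_for n I rY 4 (best_prefix ;; extend) A.
- by split=> //; rewrite mul0n; apply: steps_refl.
- move=> i B hi [sB pB]; rewrite sem_seq.
  set B1 := setr B rY i; have sB1 : steps S (i * n ^ 2) A B1 := sB.
  have [hB1 tB1 eB1 fB1 lB1] := sB1.
  have [] := best_prefixP hB1 tB1 hi; set B2 := run _ _ => a2 r2 f2 y2 [m2 l2].
  have s2 : same B1 B2 by [].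
  have hB2 := same_heap s2 hB1; have tB2 := same_table s2 tB1.
  have yi : rg B1 rY = i by [].
  have [|||s3 p3] := @extendP S B2 hB2 tB2; rewrite ?y2 ?yi //.
  + case: m2 => [->|[a en]]; [by left|right; exists a].
    exact: entry_ext (same_ext s2) en.
  + rewrite f2; apply: leq_ltn_trans f16; rewrite e6.
    apply: leq_trans (leq_add fB1 (leqnn _)) _.
    by rewrite -addnA -mulSnr leq_add2l leq_mul2r hi orbT.
  rewrite y2 yi in p3.
  have s12 : steps S 0 B1 B2.
    by split=> //; [apply: same_ext|rewrite f2 addn0|move=> h _; rewrite /len a2].
  have sB3 := steps_trans (steps_trans sB1 s12) s3.
  rewrite addn0 -mulSnr in sB3; split=> // a y q an; rewrite ltnS leq_eqVlt.
  move=> /predU1P[-> vq|yi' vq].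
    apply: leq_trans (p3 q vq) _; rewrite ltnS a2; apply: leq_trans (l2 a an) _.
    by rewrite yi; apply: lB1; apply: h6.
  case: s3 => _ _ _ _ l3; apply: leq_trans (l3 _ _) _.
    by apply: idx6; [apply: ltn_trans hi|case/andP: vq].
  by rewrite /len a2; apply: pB.
- by move: sB; rewrite -e6 => sB; split.
Qed.

Definition covd w h :=
  has (fun j => (adj (dig j h) != 0) && cov w (dig j h)) (iota 0 3).

Lemma covers_xP A q w : raw A =1 adj -> rg A rW = w -> w < n ->
  hev 16 n A q < n ^ 2 ->
  (hev 16 n A (covers_x q) != 0) = (adj (hev 16 n A q) != 0) && cov w (hev 16 n A q).
Proof.
move=> rA wA wn; set v := hev 16 n A q => vn.
have e2 : n ^ 2 = n * n by rewrite expnS expn1.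
have sm u : u < n -> (u * n + w) %% n ^ 2 = u * n + w.
  move=> un; rewrite modn_small // e2; apply: (@leq_trans (u * n + n)).
    by rewrite ltn_add2l.
  by rewrite -mulSnr leq_mul2r un orbT.
have vd : v %/ n < n by rewrite ltn_divLR -?e2 // ltnW.
have vm : v %% n < n by rewrite ltn_mod ltnW.
rewrite [hev _ _ _ _]/= -/v wA !expn1 modn_small // !sm // !rA.
rewrite muln_eq0 negb_or; congr (_ && _).
by rewrite !addn_eq0 !negb_and -!orbA !eqb0 !negbK.
Qed.

(** A triple survives only if one of its digits is an edge covering [w], and that edge occurs in the
    stored list. *)
Lemma checkP S A w (B := run check A) :
  heap A -> table A S -> rg A rW = w -> w < n ->
  [/\ heap B, table B (fun v => S v \/ v = w), ext A B, rg B rFree = rg A rFree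
    & forall h, h < n ^ 6 -> len B h <= len A h \/ ~~ covd w h].
Proof.
move=> hA tA wA wn; rewrite /B {B}.
pose I i B := [/\ raw B = raw A, rg B rFree = rg A rFree, rg B rW = w,
  forall t, t != aTab -> ar B t =1 ar A t
  & forall h, ar B aTab h = if (h < i) && ~~ covd w h then 0 else ar A aTab h].
have [||B [rB fB wB oB tB] ->] := @sem_for n I rH 6 (HIf (covers_x (HR rH mod HP 2)
  + covers_x ((HR rH / HP 2) mod HP 2) + covers_x ((HR rH / HP 4) mod HP 2))%hx
    HSkip (HPut aTab (HR rH) (HC 0))) A; first by split.
- move=> i B hi [rB fB wB oB tB]; rewrite sem_if; set c := hev _ _ _ _.
  have -> : (c == 0) = ~~ covd w i.
    rewrite -[c == 0]negbK; congr (~~ _).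
    have rB' : raw (setr B rH i) =1 adj by move=> q; rewrite /= rB; case: hA.
    have n2 : 0 < n ^ 2 by rewrite expn_gt0 ltnW.
    have cx q := @covers_xP (setr B rH i) q w rB' wB wn.
    pose v q := hev 16 n (setr B rH i) (covers_x q).
    have -> : c = v (HR rH mod HP 2)%hx + v ((HR rH / HP 2) mod HP 2)%hx
      + v ((HR rH / HP 4) mod HP 2)%hx by [].
    rewrite /v !addn_eq0 !negb_and !cx //=; try by rewrite ltn_mod.
    by rewrite /covd /= /dig !muln0 !muln1 expn0 divn1 orbF orbA.
  case: ifP => hc; split=> //.
  + move=> t ht h; rewrite /= (negbTE ht) /=; exact: oB.
  + move=> h; rewrite /= ltnS leq_eqVlt tB.
    by case: eqVneq => [->|] //=; rewrite hc.
  + move=> h; rewrite tB [in RHS]ltnS [in RHS]leq_eqVlt.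
    by case: eqVneq => [->|] //=; rewrite ltnn hc.
have eB : ext A (setr B rH (n ^ 6)).
  split=> [|t i ht hi]; [by rewrite /= fB|apply: oB];
    by move: ht; rewrite !inE => /or3P[]/eqP ->.
split=> //.
- by case: hA => h1 h2 h3 h4; split; rewrite /= ?rB ?fB ?oB.
- move=> h hh; rewrite /= tB hh /=; case: ifP => [_|/negbFE hc]; first by left.
  have [->|en] := tA h hh; [by left|right].
  have [s [hs s12 vs ds cs]] := entry_ext eB en; exists s; split=> // v [/cs//|->].
  have /hasP[j] := hc; rewrite mem_iota => /= j3 /andP[aj cj].
  by apply/hasP; exists (dig j h) => //; apply: ds.
- move=> h hh; case hc: (covd w h); [left|by right].
  by rewrite /len /= tB hc andbF oB.
Qed.

(** The index reached from the empty triple by appending the edges of [p] one at a time; the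
    reduction modulo n ^ 4 forgets the oldest of three. *)
Definition code (p : seq nat) := foldl (fun h q => h %% n ^ 4 * n ^ 2 + q) 0 p.

Lemma code_rcons p q : code (rcons p q) = code p %% n ^ 4 * n ^ 2 + q.
Proof. by rewrite /code foldl_rcons. Qed.

Lemma code_lt p : all valid p -> code p < n ^ 6.
Proof.
elim/last_ind: p => [|p q _]; first by rewrite expn_gt0 ltnW.
rewrite all_rcons code_rcons => /andP[/andP[q2 _] _].
have -> : n ^ 6 = n ^ 4 * n ^ 2 by rewrite -expnD.
apply: (@leq_trans (code p %% n ^ 4 * n ^ 2 + n ^ 2)); first by rewrite ltn_add2l.
by rewrite -mulSnr leq_mul2r ltn_mod expn_gt0 (ltnW n1) orbT.
Qed.

Lemma code_dig p i : all valid p -> i < 3 -> i < size p ->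
  dig i (code p) = nth 0 (rev p) i.
Proof.
elim/last_ind: p i => [|p q ih] i; first by [].
rewrite all_rcons code_rcons rev_rcons size_rcons => /andP[/andP[q2 _] vp].
have [d0 d1 d2] := dig_shift (code p %/ n ^ 4) (code p %% n ^ 4) q2.
rewrite -divn_eq in d1 d2.
by case: i => [|[|[|//]]] _ ip /=; rewrite ?d0 ?d1 ?d2 ?ih.
Qed.

Lemma covd_code w p i : all valid p -> i < size p -> size p <= i + 3 ->
  cov w (nth 0 p i) -> covd w (code p).
Proof.
move=> vp ip pi cw; pose j := size p - i.+1.
have dj : dig j (code p) = nth 0 p i.
  rewrite code_dig //; try by rewrite /j; lia.
  by rewrite nth_rev; [congr nth; rewrite /j; lia|rewrite /j; lia].
apply/hasP; exists j; first by rewrite mem_iota /j; lia.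
by rewrite dj cw andbT; have /(allP vp)/andP[_] := mem_nth 0 ip.
Qed.

(** The optimality half of the invariant: the entry competing with a prefix of [F] is no longer than
    it. Only lengths are compared, and the stored list may be a different one. *)
Definition reached A (F : seq nat) j := len A (code (take j F)) <= j.

Lemma pass_reached S A F j : heap A -> table A S -> rg A rFree + n ^ 6 < n ^ 16 ->
  all valid F -> reached A F j ->
  reached (run pass A) F j /\ (j < size F -> reached (run pass A) F j.+1).
Proof.
move=> hA tA f16 vF cj; have [[_ _ _ _ mono] prog] := passP hA tA f16.
have vt i : all valid (take i F).
  by apply/allP => q /mem_take; apply: allP.
split; first by apply: leq_trans (mono _ (code_lt (vt j))) cj.
move=> jF; rewrite /reached (take_nth 0) // code_rcons.
pose h := code (take j F); have h6 : h < n ^ 6 := code_lt (vt j).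
apply: leq_trans (prog (h %/ n ^ 4) (h %% n ^ 4) _ _ _ _) _.
- by rewrite ltn_divLR ?expn_gt0 ?(ltnW n1) // -expnD.
- by rewrite ltn_mod expn_gt0 ltnW.
- by apply: (allP vF); apply: mem_nth.
- by rewrite -divn_eq.
Qed.

Lemma processP S A w (B := run process A) :
  heap A -> table A S -> rg A rW = w -> w < n -> rg A rFree + 3 * n ^ 6 < n ^ 16 ->
  [/\ heap B, table B (fun v => S v \/ v = w), ext A B,
      rg B rFree <= rg A rFree + 3 * n ^ 6
    & forall F j j', all valid F -> j <= j' <= j + 3 -> j' <= size F ->
        reached A F j -> covd w (code (take j' F)) -> reached B F j'].
Proof.
move=> hA tA wA wn f16.
have f1 : rg A rFree + n ^ 6 < n ^ 16 by lia.
have [[hA1 tA1 e1 g1 _] _] := passP hA tA f1; set A1 := run pass A in hA1 tA1 e1 g1.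
have f2 : rg A1 rFree + n ^ 6 < n ^ 16 by lia.
have [[hA2 tA2 e2 g2 _] _] := passP hA1 tA1 f2; set A2 := run pass A1 in hA2 tA2 e2 g2.
have f3 : rg A2 rFree + n ^ 6 < n ^ 16 by lia.
have [[hA3 tA3 e3 g3 _] _] := passP hA2 tA2 f3; set A3 := run pass A2 in hA3 tA3 e3 g3.
have w3 : rg A3 rW = w by rewrite /A3 /A2 /A1 !sem_unwritten_reg.
have [hB tB eB fB cB] := checkP hA3 tA3 w3 wn.
rewrite -[run check A3]/B in hB tB eB fB cB.
split=> //; first exact: ext_trans (ext_trans e1 (ext_trans e2 e3)) eB.
  by rewrite fB; lia.
move=> F j j' vF hj j'F cj cov'.
(* A pass brings the table one edge of [F] further, or keeps it in place once [j'] is attained; the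
   distance left shrinks from 3 to 0. *)
have adv A' i d : heap A' -> table A' S -> rg A' rFree + n ^ 6 < n ^ 16 ->
    reached A' F i -> i <= j' <= i + d.+1 ->
    exists2 i', reached (run pass A') F i' & i' <= j' <= i' + d.
  move=> hA' tA' f' ci hi; have [c1 c2] := pass_reached hA' tA' f' vF ci.
  have [ij|ij] := eqVneq i j'; first by exists i => //; lia.
  by exists i.+1; [apply: c2|]; lia.
have [j1 cj1 hj1] := adv A j 2 hA tA f1 cj hj.
have [j2 cj2 hj2] := adv A1 j1 1 hA1 tA1 f2 cj1 hj1.
have [j3 cj3 hj3] := adv A2 j2 0 hA2 tA2 f3 cj2 hj2.
have fin : reached A3 F j' by have <- : j3 = j' by lia.
have vt : all valid (take j' F) by apply/allP => q /mem_take; apply: allP.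
by have [le|] := cB _ (code_lt vt); [apply: leq_trans le fin|rewrite cov'].
Qed.

Lemma dynprogP A (o := ar A aOrd) (B := run dynprog A) :
  heap A -> (forall c, c < n -> o c < n) ->
  rg A rFree + n * (3 * n ^ 6) < n ^ 16 ->
  [/\ heap B, table B (fun w => exists2 c, c < n & o c = w), ext A B,
      rg B rFree <= rg A rFree + n * (3 * n ^ 6)
    & forall F (j : nat -> nat), all valid F -> j 0 = 0 ->
        (forall c, c < n -> [/\ j c <= j c.+1 <= j c + 3, j c.+1 <= size F
           & covd (o c) (code (take (j c.+1) F))]) ->
        reached B F (j n)].
Proof.
move=> hA on f16; rewrite /B {B}.
have n60 : 0 < n ^ 6 by rewrite expn_gt0 ltnW.
rewrite /dynprog sem_seq.
pose I0 i B := [/\ raw B = raw A, rg B rFree = rg A rFree,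
  forall t, t != aTab -> ar B t =1 ar A t & forall h, h < i -> ar B aTab h = 0].
have [||B0 [r0 f0 o0 t0] ->] := @sem_for n I0 rH 6 (HPut aTab (HR rH) (HC 0)) A.
- by split.
- move=> i B hi [rB fB oB tB]; split=> //.
    by move=> t ht h /=; rewrite (negbTE ht) /= oB.
  by move=> h; rewrite ltnS leq_eqVlt /=; case: eqVneq => //= _ /tB.
set B1 := setr _ _ _; rewrite sem_seq; set B2 := run (HPut _ _ _) B1.
have tab2 h : h < n ^ 6 -> ar B2 aTab h = if h == 0 then 1 else 0.
  by move=> hh; rewrite /B2 /=; case: ifP => // _; apply: t0.
have oB2 t : t != aTab -> ar B2 t =1 ar A t.
  by move=> ht h; rewrite /B2 /= (negbTE ht) /=; apply: o0.
have eB2 : ext A B2.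
  by split=> [|t i ht _]; [rewrite /= f0|apply: oB2; move: ht; rewrite !inE => /or3P[]/eqP ->].
have hB2 : heap B2.
  by case: hA => h1 h2 h3 h4; split; rewrite ?oB2 //= ?r0 // f0.
have tB2 : table B2 (fun w => exists2 c, c < 0 & o c = w).
  move=> h hh; rewrite tab2 //; have [->|_] := eqVneq h 0; [right|by left].
  exists [::]; split=> //; first by rewrite expn_gt0 ltnW.
    by move=> j j3; rewrite /dig div0n mod0n adj0.
  by move=> w [].
pose I i B := [/\ heap B, table B (fun w => exists2 c, c < i & o c = w), ext A B,
  rg B rFree <= rg A rFree + i * (3 * n ^ 6) /\ ar B aOrd =1 o
  & forall F (j : nat -> nat), all valid F -> j 0 = 0 ->
        (forall c, c < n -> [/\ j c <= j c.+1 <= j c + 3, j c.+1 <= size F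
           & covd (o c) (code (take (j c.+1) F))]) ->
        reached B F (j i)].
have [||B [hB tB eB [fB _] cB] ->] := @sem_for n I rC 1 (rW ::= HA aOrd (HR rC) ;; process) B2.
- split=> //; first by split; [rewrite addn0 /= f0|apply: oB2].
  by move=> F j vF j0 _; rewrite j0 /reached take0 /len tab2 // oB2 //; case: hA => _ _ _ ->.
- rewrite expn1 => i B hi [hB tB eB [fB oB] cB]; rewrite sem_seq.
  set B' := run (HSet _ _) _.
  have wB : rg B' rW = o i by rewrite /B' /= oB.
  have f' : rg B' rFree + 3 * n ^ 6 < n ^ 16.
    apply: leq_ltn_trans f16; apply: leq_trans (leq_add fB (leqnn _)) _.
    by rewrite -addnA -mulSnr leq_add2l leq_mul2r hi orbT.
  have [hC tC eC fC cC] := @processP _ B' (o i) hB tB wB (on i hi) f'.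
  split=> //.
  + move=> h hh; case: (tC h hh) => [->|[s [s1 s2 s3 s4 s5]]]; [by left|right].
    exists s; split=> // w [c]; rewrite ltnS leq_eqVlt => /predU1P[->|ci] <-.
      by apply: s5; right.
    by apply: s5; left; exists c.
  + exact: ext_trans eB eC.
  + split; last by move=> c; rewrite sem_unwritten_array // -oB.
    by rewrite mulSnr addnA; apply: leq_trans fC _; rewrite leq_add2r.
  + move=> F j vF j0 hj; have [h1 h2 h3] := hj i hi.
    exact: (cC F (j i) (j i.+1) vF h1 h2 (cB F j vF j0 hj) h3).
by rewrite expn1 in hB tB eB fB cB *; split.
Qed.

Definition full A p := exists s,
  [/\ lst A p s, size s < n ^ 12, all valid s & forall w, w < n -> has (cov w) s].

Lemma update_bestP A (B := run update_best A) : heap A ->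
  table A (fun w => w < n) -> rg A rBest = 0 \/ full A (rg A rBest) ->
  [/\ heap B, ext A B, rg B rFree = rg A rFree & 
      [/\ rg B rBest = 0 \/ full B (rg B rBest),
      ar B aLen (rg B rBest) <= ar A aLen (rg A rBest)
    & forall h, h < n ^ 6 -> ar B aLen (rg B rBest) <= len A h]].
Proof.
move=> hA tA bA; rewrite /B {B}.
pose I i B := [/\ same A B, rg B rBest = 0 \/ full A (rg B rBest),
   ar A aLen (rg B rBest) <= ar A aLen (rg A rBest)
  & forall h, h < i -> ar A aLen (rg B rBest) <= len A h].
have [||B [sB bB lB mB] ->] := @sem_for n I rH 6
   (HIf (HA aLen (HA aTab (HR rH)) < HA aLen (HR rBest)) (rBest ::= HA aTab (HR rH)) HSkip) A.
- by split.
- move=> i B hi [sB bB lB mB]; case: (sB) => aB _ _; rewrite sem_if.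
  set c := hev _ _ _ _; have -> : c = (len A i < ar A aLen (rg B rBest)) by rewrite /c /= aB.
  case: ltnP => [lt|le] /=; split=> //=.
  + rewrite aB; have [->|[s [s1 s2 s3 _ s5]]] := tA i hi; [by left|right].
    by exists s; split.
  + by rewrite aB; apply: leq_trans (ltnW lt) lB.
  + move=> h; rewrite ltnS leq_eqVlt aB => /predU1P[->//|/mB].
    by apply: leq_trans; apply: ltnW.
  + by move=> h; rewrite ltnS leq_eqVlt => /predU1P[->|/mB].
have eB := same_ext sB; have [aB rB fB] := sB.
split=> //; first exact: same_heap sB hA.
rewrite /= aB; split=> //; case: bB => [->|[s [s1 s2 s3 s4]]]; [by left|right].
by exists s; split=> //; apply: lst_ext s1.
Qed.

(** * Breadth-first search and the choice of the source *)

Record nat_level (x : nat) (lv : nat -> nat) : Prop := NatLevel {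
  nlevel0 : forall u, u < n -> (lv u == 0) = (u == x);
  nlevel_edge : forall u v, u < n -> v < n -> adj (u * n + v) != 0 ->
    lv v <= (lv u).+1;
  nlevel_pred : forall u i, u < n -> lv u = i.+1 ->
    exists v, [/\ v < n, adj (v * n + u) != 0 & lv v = i];
  nlevel_lt : forall u, u < n -> lv u < n
}.

(** The search at layer [l] after the inner loop has handled the vertices below [w]. *)
Definition visited (lv : nat -> nat) l w u := (lv u < l) || (lv u == l) && (u < w).

Definition marks lv l w (A : hst) :=
  forall u, u < n -> ar A aLev u = if visited lv l w u then (lv u).+1 else 0.

Lemma cell_lt u w : u < n -> w < n -> u * n + w < n ^ 2.
Proof.
move=> un wn; rewrite expnS expn1; apply: (@leq_trans (u * n + n)).
  by rewrite ltn_add2l.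
by rewrite -mulSnr leq_mul2r un orbT.
Qed.

Lemma find_closerP A x lv l w (B := run find_closer A) :
  raw A =1 adj -> nat_level x lv -> marks lv l w A ->
  rg A rL = l -> rg A rW = w -> rg A rSrc = x -> w < n -> l <= lv w ->
  [/\ ar B = ar A, raw B = raw A & (rg B rF != 0) = (lv w == l)].
Proof.
move=> rA hlv mA lA wA xA wn lw; rewrite /B {B} /find_closer sem_seq.
pose P u := [&& ar A aLev u == l, 0 < l & adj (u * n + w) != 0].
pose I i B := [/\ ar B = ar A, raw B = raw A, rg B rL = l, rg B rW = w
  & (rg B rF != 0) = (l == 0) && (w == x) || has P (iota 0 i)].
have [||B [aB rB lB wB fB] ->] := @sem_for n I rU 1 (HIf ((HA aLev (HR rU) == HR rL) *
    (HC 0 < HR rL) * HW (HR rU * HP 1 + HR rW))%hx (rF ::= HC 1) HSkip)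
    (run (rF ::= HO OMul (HO OEq (HR rL) (HC 0)) (HO OEq (HR rW) (HR rSrc))) A).
- by split=> //=; rewrite lA wA xA orbF; case: (l == 0); case: (w == x).
- rewrite expn1 => i B hi [aB rB lB wB fB]; rewrite sem_if.
  set c := hev _ _ _ _; have -> : (c == 0) = ~~ P i.
    rewrite /c /= aB lB wB rB expn1 modn_small ?cell_lt // rA.
    by rewrite !muln_eq0 !eqb0 !negb_and negbK orbA.
  have hS : has P (iota 0 i.+1) = has P (iota 0 i) || P i.
    by rewrite -[i.+1]addn1 iotaD has_cat /= orbF.
  by case: ifP => hP; split=> //; rewrite hS [LHS]/= ?fB; move: hP; case: (P i); rewrite ?orbT ?orbF.
split=> //=; rewrite fB expn1.
case: (posnP l) => l0.
  subst l; rewrite l0 /= (nlevel0 hlv wn) (@eq_has _ P pred0) ?has_pred0 ?orbF //.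
  by move=> u; rewrite /P l0 /= andbF.
rewrite /=; apply/hasP/eqP => [[u]|lw'].
  rewrite mem_iota /= => un /and3P[/eqP hu _ auw]; rewrite mA // in hu.
  have := nlevel_edge hlv un wn auw; move: hu; case: ifP => [|_]; last by lia.
  by rewrite /visited; lia.
have [u [un auw lu]] := nlevel_pred hlv (i := l.-1) wn (etrans lw' (esym (prednK l0))).
exists u; first by rewrite mem_iota.
by rewrite /P l0 auw mA // /visited lu prednK // leqnn eqxx.
Qed.

(** The contents of [aOrd] at the same moment: complete layers, then the handled part of layer
    [l]. *)
Definition bfs_order lv l w :=
  flatten [seq [seq u <- iota 0 n | lv u == j] | j <- iota 0 l] ++
  [seq u <- iota 0 w | lv u == l].

Lemma size_order lv l w : size (bfs_order lv l w) <= l * n + w.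
Proof.
rewrite size_cat leq_add //; last by rewrite size_filter -[X in _ <= X](size_iota 0) count_size.
elim: l => [|l ih]; first by [].
rewrite -[l.+1]addn1 iotaD map_cat flatten_cat size_cat /= cats0 mulnDl mul1n leq_add //.
by rewrite size_filter -[X in _ <= X](size_iota 0) count_size.
Qed.

Lemma order_step lv l w :
  bfs_order lv l w.+1 = if lv w == l then rcons (bfs_order lv l w) w else bfs_order lv l w.
Proof.
rewrite /bfs_order -[w.+1]addn1 iotaD filter_cat /= add0n.
by case: ifP => _; rewrite ?cats0 // catA cats1.
Qed.

Lemma order_next lv l : bfs_order lv l n = bfs_order lv l.+1 0.
Proof.
by rewrite /bfs_order -[l.+1]addn1 iotaD map_cat flatten_cat /= add0n !cats0.
Qed.

Lemma marks_next lv l A : marks lv l n A -> marks lv l.+1 0 A.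
Proof. by move=> mA u un; rewrite mA // /visited; congr (if _ then _ else _); lia. Qed.

Lemma bfsP A x lv (B := run bfs A) : heap A -> nat_level x lv -> rg A rSrc = x ->
  [/\ heap B, ext A B, rg B rFree = rg A rFree
    & forall c, c < size (bfs_order lv n 0) -> ar B aOrd c = nth 0 (bfs_order lv n 0) c].
Proof.
move=> hA hlv xA; rewrite /B {B} /bfs sem_seq.
pose I0 i B := [/\ raw B = raw A, rg B rFree = rg A rFree, rg B rSrc = x,
  forall t, t != aLev -> ar B t =1 ar A t & forall u, u < i -> ar B aLev u = 0].
have [||B0 [r0 f0 x0 o0 t0] ->] := @sem_for n I0 rW 1 (HPut aLev (HR rW) (HC 0)) A.
- by split.
- move=> i B hi [rB fB xB oB tB]; split=> //.
    by move=> t ht h /=; rewrite (negbTE ht) /= oB.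
  by move=> h; rewrite ltnS leq_eqVlt /=; case: eqVneq => //= _ /tB.
rewrite sem_seq; set B1 := run (HSet _ _) _; rewrite expn1 in t0.
pose J l w B := [/\ raw B =1 adj, rg B rFree = rg A rFree /\ rg B rSrc = x,
  forall t, t != aLev -> t != aOrd -> ar B t =1 ar A t, marks lv l w B
  & rg B rCnt = size (bfs_order lv l w) /\ forall c, c < size (bfs_order lv l w) ->
      ar B aOrd c = nth 0 (bfs_order lv l w) c].
have J0 : J 0 0 B1.
  split=> //; first by move=> q; rewrite /B1 /= r0; case: hA.
    by move=> t t1 t2; apply: o0.
  by move=> u un; rewrite /B1 /= t0 // /visited ltn0 andbF.
have [||B [rB [fB xB] oB mB [cB sB]] ->] := @sem_for n (fun l B => J l 0 B) rL 1
    (HFor rW 1 (HIf (HA aLev (HR rW) == HC 0)%hx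
    (find_closer ;;
     HIf (HR rF)
       (HPut aLev (HR rW) (HM (HR rL + HC 1)) ;;
        HPut aOrd (HR rCnt) (HR rW) ;;
        rCnt ::= HM (HR rCnt + HC 1)) HSkip) HSkip)) B1; first exact: J0.
- rewrite expn1 => l B hl JB.
  have [||C [[rC [fC xC] oC mC [cC sC]] lC] ->] := @sem_for n (fun w B => J l w B /\ rg B rL = l)
    rW 1 (HIf (HA aLev (HR rW) == HC 0)%hx
    (find_closer ;;
     HIf (HR rF)
       (HPut aLev (HR rW) (HM (HR rL + HC 1)) ;;
        HPut aOrd (HR rCnt) (HR rW) ;;
        rCnt ::= HM (HR rCnt + HC 1)) HSkip) HSkip) (setr B rL l); first by [].
    rewrite expn1 => w C hw [[rC [fC xC] oC mC [cC sC]] lC]; rewrite sem_if.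
    set C1 := setr C rW w.
    have skip D : lv w != l -> ar D = ar C -> raw D = raw C ->
        (forall y, y \notin [:: rF; rU; rW] -> rg D y = rg C y) ->
        J l w.+1 D /\ rg D rL = l.
      move=> lw aD rD gD; split; last by rewrite gD.
      rewrite /J order_step (negbTE lw) aD rD !gD //; split=> // u un.
      rewrite aD mC // /visited; congr (if _ then _ else _).
      by case: (eqVneq u w) => [->|]; lia.
    have hm := mC w hw; rewrite /visited ltnn andbF orbF in hm.
    have -> : (hev 16 n C1 (HA aLev (HR rW) == HC 0)%hx == 0) = (lv w < l).
      by rewrite /= hm; case: ltnP.
    have skip1 : lv w != l -> J l w.+1 C1 /\ rg C1 rL = l.
      move=> h; apply: skip => // y; rewrite !inE !negb_or => /and3P[_ _ /negbTE yW].
      by rewrite /= yW.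
    case: ltnP => lw; first by apply: skip1; lia.
    rewrite sem_seq.
    have [aD rD gD] := @find_closerP C1 x lv l w rC hlv mC lC erefl xC hw lw.
    have wr y : y \notin [:: rF; rU] -> rg (run find_closer C1) y = rg C1 y.
      by move=> hy; apply: sem_unwritten_reg; move: hy; rewrite /= !inE; lia.
    move: aD rD gD wr; move: (run find_closer C1) => D aD rD gD wr.
    rewrite sem_if [hev _ _ _ _]/=; case: ifP => hF; rewrite hF in gD; last move/esym/eqP: gD => lwl.
      have lw' : lv w != l by rewrite -gD.
      apply: (skip D lw' aD rD) => y; rewrite !inE !negb_or => /and3P[h1 h2 h3].
      by rewrite /= wr ?inE ?negb_or ?h1 //= (negbTE h3).
    have D3 : rg D rW = w by rewrite wr.
    have Dl : rg D rL = l by rewrite wr.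
    have Dc : rg D rCnt = size (bfs_order lv l w) by rewrite wr.
    have n2 : n ^ 2 = n * n by rewrite expnS expn1.
    have n16 : n ^ 2 < n ^ 16 by rewrite ltn_exp2l.
    have cnt : size (bfs_order lv l w) < n ^ 2.
      by apply: leq_ltn_trans (size_order _ _ _) _; rewrite n2; nia.
    rewrite [sem _ _ _ _]/= Dl D3 Dc !modn_small; try by rewrite ?addn1; nia.
    split; last by rewrite /= Dl.
    rewrite /J order_step lwl eqxx size_rcons addn1; split=> //=.
    + by rewrite rD.
    + by rewrite !wr.
    + by move=> t t2 t3 i; rewrite (negbTE t2) (negbTE t3) /= aD; apply: oC.
    + move=> u un /=; rewrite aD /= mC // /visited.
      case: (eqVneq u w) => [->|ne]; first by rewrite lwl ltnn eqxx ltnSn.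
      by congr (if _ then _ else _); lia.
    + split=> [|c]; first by rewrite addn1.
      rewrite ltnS leq_eqVlt nth_rcons aD.
      by case: eqVneq => [-> _|ne /= h]; rewrite ?ltnn // h sC.
  rewrite expn1 order_next in mC cC sC.
  by split=> //; apply: (marks_next (A := C)).
rewrite expn1 in mB cB sB.
split=> //.
- by case: hA => h1 h2 h3 h4; split; rewrite /= ?oB ?fB.
- by split; [rewrite /= fB|move=> t i; rewrite !inE => /or3P[]/eqP -> _; apply: oB].
Qed.

Lemma mem_order lv u : (forall v, v < n -> lv v < n) ->
  (u \in bfs_order lv n 0) = (u < n).
Proof.
move=> hlv; rewrite /bfs_order cats0; apply/flattenP/idP => [[s /mapP[j _ ->]]|un].
  by rewrite mem_filter mem_iota => /andP[].
exists [seq v <- iota 0 n | lv v == lv u]; last by rewrite mem_filter eqxx mem_iota.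
by apply: (map_f (fun j => [seq v <- iota 0 n | lv v == j])); rewrite mem_iota hlv.
Qed.

Lemma size_order_le lv l : size (bfs_order lv l 0) <= n.
Proof.
rewrite /bfs_order cats0 size_flatten /shape -map_comp sumnE big_map.
rewrite (eq_bigr (fun j => \sum_(u <- iota 0 n) (lv u == j))) => [|j _]; last first.
  by rewrite /= size_filter -sum1_count big_mkcond /=; apply: eq_bigr => u _; case: (_ == _).
rewrite exchange_big /= -[X in _ <= X](size_iota 0) -sum1_size; apply: leq_sum => u _.
rewrite (eq_bigr (fun j => (j == lv u) * 1)) => [|j _]; last by rewrite muln1 eq_sym.
have := count_uniq_mem (lv u) (iota_uniq 0 l); rewrite -sum1_count big_mkcond /=.
move=> h; apply: leq_trans (leq_b1 (lv u \in iota 0 l)); rewrite -h.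
by apply: eq_leq; apply: eq_bigr => j _; case: (_ == _).
Qed.

Lemma order_perm lv : (forall v, v < n -> lv v < n) -> size (bfs_order lv n 0) = n.
Proof.
move=> hlv; apply/eqP; rewrite eqn_leq size_order_le -[X in X <= _](size_iota 0).
by apply: uniq_leq_size (iota_uniq _ _) _ => u; rewrite mem_iota mem_order.
Qed.

Lemma order_sorted lv l c c' : c <= c' -> c' < size (bfs_order lv l 0) ->
  lv (nth 0 (bfs_order lv l 0) c) <= lv (nth 0 (bfs_order lv l 0) c').
Proof.
elim: l c c' => [|l ih] c c' cc'; first by [].
have lo : forall u, u \in bfs_order lv l 0 -> lv u < l.
  move=> u; rewrite /bfs_order cats0 => /flattenP[s /mapP[j jl ->]].
  by rewrite mem_filter => /andP[/eqP -> _]; move: jl; rewrite mem_iota.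
have -> : bfs_order lv l.+1 0 = bfs_order lv l 0 ++ [seq u <- iota 0 n | lv u == l].
  by rewrite -order_next /bfs_order cats0.
set s := bfs_order lv l 0; set t := filter _ _.
have ht u : u \in t -> lv u = l by rewrite mem_filter => /andP[/eqP].
rewrite size_cat (nth_cat 0 s t c) (nth_cat 0 s t c') => hc'.
have [c's|c's] := ltnP c' (size s).
  by rewrite (leq_ltn_trans cc' c's); apply: ih.
have ct i : size s <= i -> i <= c' -> lv (nth 0 t (i - size s)) = l.
  by move=> si ic; apply/ht/mem_nth; rewrite ltn_subLR //; apply: leq_ltn_trans hc'.
rewrite (ct c' c's (leqnn _)); have [cs|cs] := ltnP c (size s).
  by apply/ltnW/lo/mem_nth.
by rewrite (ct c cs cc').
Qed.

Lemma full_ext A B p : ext A B -> full A p -> full B p.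
Proof. by move=> eAB [s [h1 h2 h3 h4]]; exists s; split=> //; apply: lst_ext h1. Qed.

Lemma full_len A B p : heap A -> ext A B -> p = 0 \/ full A p ->
  ar B aLen p = ar A aLen p.
Proof.
move=> hA [_ eAB] hp; apply: eAB; first by rewrite !inE.
case: hA => _ f1 _ _; case: hp => [->|[s [hs _ _ _]]]; first exact: ltnW.
by have /andP[] := lst_bound f1 hs.
Qed.

(** Every source must be sound, but the schedule [j] is given for the single source [x0]; its round
    brings the best length down to [size F], and later rounds cannot raise it. *)
Lemma find_coverP A x0 lv0 F (j : nat -> nat) (B := run find_cover A) :
  raw A =1 adj -> rg A rBest = 0 -> ar A aLen 1 = 0 ->
  (forall x, x < n -> exists2 lv, nat_level x lv & x = x0 -> lv = lv0) ->
  x0 < n -> all valid F -> size F < n ^ 12 -> j 0 = 0 ->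
  (forall c, c < n -> [/\ j c <= j c.+1 <= j c + 3, j c.+1 <= size F
     & covd (nth 0 (bfs_order lv0 n 0) c) (code (take (j c.+1) F))]) ->
  [/\ heap B, full B (rg B rBest) & ar B aLen (rg B rBest) <= size F].
Proof.
move=> rA bA l1 hlv x0n vF sF j0 hj; rewrite /B {B} /find_cover 2!sem_seq.
set A1 := run (HSet _ _) _; pose K := n * (3 * n ^ 6).
have hA1 : heap A1 by [].
(* All sources together store at most 3 * n ^ 8 nodes, next to the two reserved cells. *)
have K16 : 2 + n * K < n ^ 16.
  have -> : n * K = 3 * n ^ 8.
    by rewrite /K mulnCA [n * (3 * _)]mulnCA -!expnS.
  have -> : n ^ 16 = n ^ 8 * n ^ 8 by rewrite -expnD.
  have h8 : 2 ^ 8 <= n ^ 8 by rewrite leq_exp2r.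
  have h256 : 2 ^ 8 = 256 by []. 
  by rewrite h256 in h8; nia.
pose I i B := [/\ heap B, rg B rFree <= 2 + i * K,
  rg B rBest = 0 \/ full B (rg B rBest)
  & x0 < i -> ar B aLen (rg B rBest) <= size F].
have [||B [hB fB bB lB] ->] := @sem_for n I rSrc 1 (bfs ;; dynprog ;; update_best) A1.
- by split=> //; left.
- rewrite expn1 => i B hi [hB fB bB lB]; rewrite 2!sem_seq.
  set B1 := setr B rSrc i; have [lv hl lv_eq] := hlv i hi.
  have lt := nlevel_lt hl.
  have [h2 e2 f2 o2] := @bfsP B1 i lv hB hl erefl.
  have g2 : rg (run bfs B1) rBest = rg B rBest by rewrite sem_unwritten_reg.
  move: h2 e2 f2 o2 g2; move: (run bfs B1) => B2 h2 e2 f2 o2 g2.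
  rewrite order_perm // in o2.
  have on c : c < n -> ar B2 aOrd c < n.
    by move=> cn; rewrite o2 // -(@mem_order lv) // mem_nth // order_perm.
  have fK : rg B2 rFree + K < n ^ 16.
    rewrite f2; apply: leq_ltn_trans K16; apply: leq_trans (leq_add fB (leqnn _)) _.
    by rewrite -addnA -mulSnr leq_add2l leq_mul2r hi orbT.
  have [h3 t3 e3 f3 c3] := dynprogP h2 on fK.
  have g3 : rg (run dynprog B2) rBest = rg B rBest by rewrite sem_unwritten_reg.
  move: h3 t3 e3 f3 c3 g3; move: (run dynprog B2) => B3 h3 t3 e3 f3 c3 g3.
  have e13 : ext B B3 := ext_trans e2 e3.
  have t3' : table B3 (fun w => w < n).
    move=> h hh; case: (t3 h hh) => [->|[s [s1 s2 s3 s4 s5]]]; [by left|right].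
    exists s; split=> // w wn; apply: s5; exists (index w (bfs_order lv n 0)).
      by rewrite -[X in _ < X](order_perm lt) index_mem mem_order.
    by rewrite o2 ?nth_index ?mem_order // -[X in _ < X](order_perm lt) index_mem mem_order.
  have b3 : rg B3 rBest = 0 \/ full B3 (rg B3 rBest).
    by rewrite g3; case: bB => [->|fb]; [left|right; apply: full_ext fb].
  have [h4 e4 f4 [b4 l4 m4]] := update_bestP h3 t3' b3.
  split=> //.
    rewrite f4 mulSnr addnA; apply: leq_trans f3 _; rewrite f2 leq_add2r; exact: fB.
  rewrite ltnS leq_eqVlt => /predU1P[xi|/lB le]; last first.
    apply: leq_trans l4 _; rewrite g3 (full_len _ e13) //.
  subst i; have jn : j n <= size F.
    have [|_ + _] := hj n.-1; first lia.
    by rewrite prednK //; lia.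
  have := c3 F j vF j0; rewrite /reached => /(_ _) h.
  apply: leq_trans (m4 (code (take (j n) F)) _) _.
    by apply: code_lt; apply/allP => q /mem_take; apply: allP.
  apply: leq_trans jn; apply: h => c cn.
  by rewrite o2 // lv_eq //; apply: hj.
have le : ar B aLen (rg B rBest) <= size F by apply: lB; rewrite expn1.
(* Had no cover been found, [rBest] would be cell 0, whose length n ^ 12 exceeds [size F]. *)
split=> //; case: bB => // b0; move: le; rewrite b0; case: hB => _ _ -> _; lia.
Qed.
End Run.

(** * From an edge cover to a paired dominating set *)

Section Pairing.
Variables (n : nat) (e : rel 'I_n).
Hypotheses (es : symmetric e) (ei : irreflexive e) (n1 : 1 < n).

Local Notation run := (sem 16 n).
Local Notation adj := (adj_cell e).
Implicit Types (u v w : 'I_n) (D : {set 'I_n}) (F G : seq ('I_n * 'I_n)).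

Definition cell (p : 'I_n * 'I_n) : nat := p.1 * n + p.2.

Lemma cell_div p : cell p %/ n = p.1.
Proof. by rewrite /cell divnMDl ?(ltnW n1) // divn_small ?addn0. Qed.

Lemma cell_mod p : cell p %% n = p.2.
Proof. by rewrite /cell modnMDl modn_small. Qed.

Lemma adj_cellE u v : adj (u * n + v) = e u v.
Proof.
rewrite /adj_cell; congr nat_of_bool; apply/existsP/idP => [[u' /existsP[v' /andP[/eqP h]]]|euv].
  have hc : cell (u, v) = cell (u', v') := h.
  have := congr1 (divn ^~ n) hc; have := congr1 (modn ^~ n) hc.
  by rewrite !cell_div !cell_mod => /val_inj /= -> /val_inj /= ->.
by exists u; apply/existsP; exists v; rewrite eqxx.
Qed.

Lemma valid_cell p : e p.1 p.2 -> valid n adj (cell p).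
Proof. by move=> ep; rewrite /valid cell_lt //= adj_cellE ep. Qed.

Lemma valid_decode s : all (valid n adj) s ->
  exists2 F, s = map cell F & forall p, p \in F -> e p.1 p.2.
Proof.
elim: s => [|q s ih] /=; first by exists [::].
move=> /andP[/andP[_ aq] /ih[F -> hF]]; move: aq; rewrite eqb0 negbK.
move=> /existsP[u /existsP[v /andP[/eqP -> euv]]]; exists ((u, v) :: F) => // p.
by rewrite inE => /predU1P[->|/hF].
Qed.

Lemma cov_cell w p : cov n adj w (cell p) = covers e w p.
Proof.
rewrite /cov cell_div cell_mod !adj_cellE !eqb0 !negbK /covers !in_nbh.
rewrite -!val_eqE !(eq_sym (val w)) -!orbA; congr (_ || _); exact: orbCA.
Qed.

Definition dom (A : hst) D := forall i : 'I_n, ar A aDom i = (i \in D).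

Lemma find_partnerP A D (y u v : 'I_n) (B := run find_partner A) :
  raw A =1 adj -> dom A D -> rg A rE = y -> rg A rU = u -> rg A rV = v -> e u v ->
  [/\ ar B = ar A, raw B = raw A
    & (rg B rF = 0 /\ forall z, e y z -> z \in D) \/
      rg B rF != 0 /\ exists g : 'I_n, [/\ rg B rG = g, e y g, g \notin D
        & y = u -> v \notin D -> g = v]].
Proof.
move=> rA dA yA uA vA euv; rewrite /B {B} /find_partner 2!sem_seq.
pose I i B := [/\ ar B = ar A, raw B = raw A, rg B rE = y /\ rg B rU = u /\ rg B rV = v
    & (rg B rF = 0 /\ forall z : 'I_n, z < i -> e y z -> z \in D) \/
      rg B rF != 0 /\ exists g : 'I_n, [/\ rg B rG = g, e y g & g \notin D]].
have [||B [aB rB [yB [uB vB]] fB] ->] := @sem_for n I rZ 1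
  (HIf (HW (HR rE * HP 1 + HR rZ) * (HA aDom (HR rZ) == HC 0))%hx
     (rF ::= HC 1 ;; rG ::= HR rZ) HSkip) (run (rF ::= HC 0) A).
- by split=> //; left.
- rewrite expn1 => i B hi [aB rB [yB [uB vB]] fB].
  have [z zi] : exists z : 'I_n, z = i :> nat by exists (Ordinal hi).
  subst i.
  rewrite sem_if; set c := hev _ _ _ _.
  have -> : (c == 0) = ~~ (e y z && (z \notin D)).
    rewrite /c /= yB rB expn1 modn_small ?cell_lt // rA (adj_cellE y z) aB (dA z).
    by case: (e y z); case: (z \in D).
  case: ifP => hz; split=> //.
    case: fB => [[f0 fz]|[f1 [g [g1 g2 g3]]]]; last by right; split=> //; exists g.
    left; split=> // z'; rewrite ltnS leq_eqVlt => /predU1P[/val_inj zi|/fz//] eyz.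
    by apply: contraTT hz => zD; rewrite negbK -zi eyz zD.
  by right; split=> //; exists z; move/negbFE: hz => /andP[-> ->].
rewrite sem_if; set c := hev _ _ _ _.
have -> : (c == 0) = ~~ ((y == u) && (v \notin D)).
  by rewrite /c /= yB uB vB aB (dA v) val_eqE; case: (y == u); case: (v \in D).
case: ifP => hc; split=> //=; case: fB => [[f0 fz]|[f1 [g [g1 g2 g3]]]].
- by left; split=> // z; apply: fz; rewrite expn1.
- right; split=> //; exists g; split=> // yu vD.
  by rewrite yu eqxx vD in hc.
- move/negbFE: hc => /andP[/eqP yu vD].
  by have := fz v; rewrite expn1 ltn_ord yu (negbTE vD) => /(_ isT euv).
- right; split=> //; exists v; move/negbFE: hc => /andP[/eqP yu vD].
  by split=> //; rewrite yu.
Qed.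

Lemma pair_edgeP A D G u v (B := run pair_edge A) :
  raw A =1 adj -> dom A D -> ar A aEdge (rg A rP) = cell (u, v) -> e u v ->
  pairing e G D ->
  [/\ exists2 D', pairing e ((u, v) :: G) D' & dom B D', raw B = raw A,
      forall t, t != aDom -> ar B t =1 ar A t, rg B rFree = rg A rFree
    & rg B rP = ar A aPrev (rg A rP)].
Proof.
move=> rA dA hq euv hp; rewrite /B {B} /pair_edge.
rewrite 4!sem_seq; set A1 := run (rU ::= _) A; set A2 := run (rV ::= _) A1.
set A3 := run (HIf _ _ _) A2.
pose y := if u \in D then v else u.
have u3 : rg A3 rU = u.
  by rewrite sem_unwritten_reg //= hq expn1 cell_div.
have v3 : rg A3 rV = v by rewrite sem_unwritten_reg //= hq expn1 cell_mod.
have same3 : [/\ ar A3 = ar A, raw A3 = raw A, rg A3 rFree = rg A rFree & rg A3 rP = rg A rP].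
  by rewrite /A3 sem_if; case: ifP.
have y3 : rg A3 rE = y.
  have u2 : rg A2 rU = u by rewrite /A2 /A1 /= hq expn1 cell_div.
  have v2 : rg A2 rV = v by rewrite /A2 /A1 /= hq expn1 cell_mod.
  have hc : hev 16 n A2 (HA aDom (HR rU)) = (u \in D).
    exact: etrans (congr1 (ar A aDom) u2) (dA u).
  by rewrite /A3 sem_if hc /y; case: (u \in D); [exact: v2|exact: u2].
move: u3 v3 same3 y3; move: A3 => A3 u3 v3 [a3 r3 f3 p3] y3.
have [s1 s2 s3] := pairing_step es ei hp euv; rewrite -/y in s1 s2 s3.
have d3 : dom A3 D by move=> i; rewrite a3.
have hc : hev 16 n A3 (HA aDom (HR rE)) = (y \in D).
  exact: etrans (congr1 (ar A3 aDom) y3) (d3 y).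
rewrite sem_if hc; case: (boolP (y \in D)) => yD.
  by split=> //=; rewrite ?a3 ?p3 //; exists D; [apply: s1 | move=> i; rewrite /= a3].
rewrite [X in run (rP ::= _) X]/= -[X in run (rP ::= _) X]/(run (HIf (HR rF)
  (HPut aDom (HR rE) (HC 1) ;; HPut aDom (HR rG) (HC 1)) HSkip) (run find_partner A3)).
have rA3 : raw A3 =1 adj by move=> q; rewrite r3.
have [] := find_partnerP rA3 d3 y3 u3 v3 euv.
have : rg (run find_partner A3) rE = y by rewrite sem_unwritten_reg.
have : rg (run find_partner A3) rFree = rg A rFree by rewrite sem_unwritten_reg.
have : rg (run find_partner A3) rP = rg A rP by rewrite sem_unwritten_reg.
move: (run find_partner A3) => A4 p4 f4 y4 a4 r4 hF.
rewrite sem_if [hev _ _ _ _]/=; case: hF => [[-> hz]|[/negbTE -> [g [gG eyg gD hg]]]].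
  split=> //=; rewrite ?a4 ?r4 ?a3 ?p4 //.
  by exists D; [apply: s2 | move=> i; rewrite /= a4 a3].
split=> //=.
- exists (y |: (g |: D)); last first.
    by move=> i; rewrite /= gG y4 a4 a3 !inE -!val_eqE dA; do 2 case: (_ == _).
  apply: s3 => // uD; apply: hg; by rewrite /y (negbTE uD).
- by rewrite r4.
- by move=> t ht i; rewrite (negbTE ht) /= a4 a3.
- by rewrite p4 a4 a3.
Qed.

Lemma pair_coverP A F (B := run pair_cover A) :
  raw A =1 adj -> dom A set0 -> ar A aLen 1 = 0 -> lst A (rg A rBest) (map cell F) ->
  (forall p, p \in F -> e p.1 p.2) -> size F <= n ->
  exists2 D, pairing e F D & forall i : 'I_n, raw B i = (i \in D).
Proof.
move=> rA dA l1 hF eF sF; rewrite /B {B} /pair_cover 2!sem_seq.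
pose I i B := [/\ raw B = raw A, forall t, t != aDom -> ar B t =1 ar A t,
  rg B rFree = rg A rFree
  & exists G F' D, [/\ pairing e G D, dom B D, lst A (rg B rP) (map cell F'),
      perm_eq (G ++ F') F & size F' = size F - i]].
have [||B [rB oB fB [G [F' [D [pD dD _ pF sF']]]]] ->] := @sem_for n I rI 1
  (HIf (HA aLen (HR rP)) pair_edge HSkip) (run (rP ::= HR rBest) A).
- split=> //; exists [::], F, set0; split=> //; last by rewrite subn0.
  exact: pairing_nil.
- rewrite expn1 => i B hi [rB oB fB [G [F' [D [pD dD lD pF sF']]]]].
  set B1 := setr B rI i; rewrite sem_if [hev _ _ _ _]/= oB //.
  case: F' lD pF sF' => [|[u v] F'] lD pF sF'.
    rewrite [rg B rP]lD l1 /=; split=> //; exists G, [::], D; split=> //.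
    by move: sF' => /=; lia.
  have [p1 pf pe pl ps] := lD; rewrite pl /=.
  have uvF : (u, v) \in F by rewrite -(perm_mem pF) mem_cat inE eqxx orbT.
  have rB1 : raw B1 =1 adj by move=> q; rewrite /= rB.
  have eB1 : ar B1 aEdge (rg B1 rP) = cell (u, v) by rewrite /= oB.
  have [[D' pD' dD'] r' o' f' p'] := pair_edgeP rB1 dD eB1 (eF _ uvF) pD.
  split=> //; [by rewrite r'|by move=> t ht j; rewrite o' //; apply: oB|by rewrite f'|].
  exists ((u, v) :: G), F', D'; split=> //; first by rewrite p' /= oB.
    by rewrite /= -cat1s perm_catCA in pF.
  by move: sF' => /=; lia.
have F0 : F' = [::] by apply: size0nil; rewrite sF' expn1; lia.
rewrite F0 cats0 in pF; exists D.
  have [h1 h2 h3] := pD; split=> //; first by rewrite -(perm_size pF).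
  by move=> w; rewrite -(perm_has _ pF); apply: h3.
set B1 := setr B _ _; pose J i C := (forall j : 'I_n, ar C aDom j = (j \in D)) /\
  forall j : 'I_n, j < i -> raw C j = (j \in D).
have [||C [_ hC] ->] := @sem_for n J rI 1 (HOut (HR rI) (HA aDom (HR rI))) B1.
- by [].
- rewrite expn1 => i C hi [dC hC]; split=> // j; rewrite ltnS leq_eqVlt /=.
  have i2 : i < n ^ 2 by rewrite expnS expn1; nia.
  rewrite modn_small //; case: eqVneq => [ji|_] /=; last exact: hC.
  by rewrite -ji dC.
by move=> i; apply: hC; rewrite expn1.
Qed.
End Pairing.

(** * The theorem *)

Section Main.
Variables (n : nat) (e : rel 'I_n).
Hypotheses (es : symmetric e) (ei : irreflexive e) (n1 : 1 < n).
Hypotheses (conn : forall x y, connect e x y) (iso : no_isolated e) (AT : AT_free e).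

Local Notation adj := (adj_cell e).

Lemma adj_cell0 : adj 0 = 0.
Proof.
pose z := Ordinal (ltnW n1); have := adj_cellE e n1 z z.
by rewrite [X in adj X]/= ei.
Qed.

Lemma adj_cell_out a : n ^ 2 <= a -> adj a = 0.
Proof.
move=> ha; rewrite /adj_cell; apply/eqP; rewrite eqb0.
apply/existsPn => i; apply/existsPn => j; apply/negP => /andP[/eqP ai _].
by have := cell_lt (ltn_ord i) (ltn_ord j); rewrite -ai ltnNge ha.
Qed.

Definition lift_level (lv : 'I_n -> nat) (u : nat) := oapp lv 0 (insub u).

Lemma lift_levelE lv (u : 'I_n) : lift_level lv u = lv u.
Proof. by rewrite /lift_level valK. Qed.

Lemma nat_level_lift (x : 'I_n) lv : level e x lv -> (forall u, lv u < n) ->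
  nat_level n adj x (lift_level lv).
Proof.
move=> hlv lt; split.
- by move=> u un; rewrite (lift_levelE lv (Ordinal un)) (level0 hlv).
- move=> u v un vn; rewrite (lift_levelE lv (Ordinal un)) (lift_levelE lv (Ordinal vn)).
  by rewrite (adj_cellE e n1 (Ordinal un) (Ordinal vn)) eqb0 negbK => h; exact: (level_edge hlv h).
- move=> u i un; rewrite (lift_levelE lv (Ordinal un)) => /(level_pred hlv)[v evu lvv].
  exists v; split; [exact: ltn_ord| |by rewrite lift_levelE].
  by rewrite (adj_cellE e n1 v (Ordinal un)) evu.
- by move=> u un; rewrite (lift_levelE lv (Ordinal un)).
Qed.

(** Bounds a minimum cover by n, as needed for the n rounds of [pair_cover] and for the sentinel n ^
    12. *)
Lemma small_cover : exists2 F, edge_cover e F & size F <= n.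
Proof.
pose nb w := odflt w [pick u | e w u].
have nbP w : e w (nb w).
  rewrite /nb; case: pickP => [u //|h]; have [u] := iso w; by rewrite h.
exists [seq (w, nb w) | w <- enum 'I_n]; last by rewrite size_map -cardE card_ord.
apply/edge_coverP; split=> [p /mapP[w _ ->]|w]; first exact: nbP.
exists (w, nb w); first by apply: map_f; rewrite mem_enum.
by rewrite /covers in_nbh eqxx.
Qed.

Lemma prog_correct A : raw A =1 adj -> (forall x, rg A x.+1 = 0) ->
  (forall t i, ar A t i = 0) ->
  exists2 D, minimum_paired_dominating e D &
    forall i : 'I_n, raw (sem 16 n prog A) i = (i \in D).
Proof.
move=> rA gA aA.
have [x adm] : exists x, admissible e x.
  by apply: admissible_exists => //; rewrite card_ord ltnW.
have levels (y : 'I_n) : exists2 lv, level e y lv & forall u, lv u < n.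
  by have [lv h1 h2] := level_exists (conn y); exists lv => // u; rewrite -[n]card_ord.
have [lv hlv lt] := levels x.
have nl := nat_level_lift hlv lt.
have [F [cF minF wF]] := good_cover es ei iso hlv adm.
set l := lift_level lv in nl *.
have ltl : forall v, v < n -> l v < n := nlevel_lt nl.
have so := order_perm ltl.
pose o c := insubd x (nth 0 (bfs_order n l n 0) c).
have oE c : c < n -> nat_of_ord (o c) = nth 0 (bfs_order n l n 0) c.
  move=> cn; rewrite /o -[nat_of_ord _]/(val _) val_insubd ifT //.
  by rewrite -(mem_order _ ltl) mem_nth // so.
have osort c c' : c <= c' -> c' < n -> lv (o c) <= lv (o c').
  move=> compile cn; rewrite -(lift_levelE lv (o c)) -(lift_levelE lv (o c')).
  rewrite (oE c (leq_ltn_trans compile cn)) (oE c' cn).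
  by apply: order_sorted; rewrite ?so.
have osurj (v : 'I_n) : exists2 c, c < n & o c = v.
  pose c := index (nat_of_ord v) (bfs_order n l n 0).
  have vo : nat_of_ord v \in bfs_order n l n 0 by rewrite (mem_order _ ltl).
  have cn : c < n by move: vo; rewrite -index_mem so.
  by exists c => //; apply: ord_inj; rewrite (oE c cn) nth_index.
have [s ps [j j0 hj]] := schedule_exists es hlv cF wF osort osurj.
have ss : size s = size F by apply: perm_size.
have [eF covF] := edge_coverP _ _ cF.
pose Fc := map (@cell n) s.
have vF : all (valid n adj) Fc.
  apply/allP => q /mapP[p pF ->]; apply: valid_cell => //.
  by apply: eF; rewrite -(perm_mem ps).
have Fn : size F <= n by have [F' /minF h1 h2] := small_cover; apply: leq_trans h1 h2.
have Fn12 : size Fc < n ^ 12.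
  rewrite size_map ss; apply: leq_ltn_trans Fn _; rewrite -[X in X < _]expn1 ltn_exp2l //.
have lvs y : y < n -> exists2 l', nat_level n adj y l' & y = x -> l' = l.
  move=> yn; have [->|yx] := eqVneq y (val x); first by exists l.
  have [lv' h1 h2] := levels (Ordinal yn); exists (lift_level lv').
    exact: nat_level_lift h1 h2.
  by move=> yx'; rewrite yx' eqxx in yx.
have sched c : c < n -> [/\ j c <= j c.+1 <= j c + 3, j c.+1 <= size Fc
     & covd n adj (nth 0 (bfs_order n l n 0) c) (code n (take (j c.+1) Fc))].
  move=> cn; have [h1 h2 [i [h3 h4]]] := hj c cn; split=> //; first by rewrite size_map.
  have sj : size (take (j c.+1) Fc) = j c.+1 by rewrite size_takel // size_map.
  have /andP[ij ji] := h3.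
  apply: (@covd_code n adj n1 adj_cell0 _ _ i); rewrite ?sj //.
    by apply/allP => q /mem_take; apply: allP.
  rewrite nth_take // (nth_map (x, x)); last exact: leq_trans ij h2.
  by rewrite -oE // cov_cell.
have [hB [sb [lb szb vb covb]] leB] :=
  @find_coverP n adj n1 adj_cell0 A x l Fc j rA (gA _) (aA _ _) lvs (ltn_ord x) vF Fn12 j0 sched.
have domB : dom (sem 16 n find_cover A) (set0 : {set 'I_n}).
  by by move=> i; rewrite sem_unwritten_array // aA inE.
rewrite -[sem 16 n prog A]/(sem 16 n pair_cover (sem 16 n find_cover A)).
move: hB lb leB domB; move: (sem 16 n find_cover A) => B hB lb leB domB.
have [Fb sbE eFb] := valid_decode vb; subst sb.
have lenb : ar B aLen (rg B rBest) = size Fb by rewrite (lst_len hB lb) size_map.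
have cFb : edge_cover e Fb.
  apply/edge_coverP; split=> // w.
  have /hasP[q /mapP[p pF ->]] := covb w (ltn_ord w); rewrite cov_cell // => pw.
  by exists p.
have leF : size Fb <= size F by rewrite -lenb -ss -(size_map (@cell n) s).
have [rB _ _ lB1] := hB.
have [D pD hD] := pair_coverP es ei n1 rB domB lB1 lb eFb (leq_trans leF Fn).
exists D => //; apply: (pairing_minimum es ei cFb _ pD) => F' /minF.
exact: leq_trans.
Qed.
End Main.

(** The exponent 8 is [time_degree prog]: 1 for the source, 1 for the scanned vertex, 6 for a sweep
    of the table. *)
Lemma cost_bound C n : 0 < n ->
  (INR (C * n ^ 8) <= INR C * Rpower (INR n) 8.5)%Re.
Proof.
move=> n0; have n1 : (1 <= INR n)%Re by rewrite -[1%Re]/(INR 1); apply: le_INR; lia.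
have -> : INR (C * n ^ 8) = (INR C * INR n ^ 8)%Re.
  by rewrite mult_INR; congr Rmult; rewrite -pow_INR; congr INR; rewrite /=; lia.
apply: Rmult_le_compat_l; first exact: pos_INR.
rewrite -Rpower_pow; last lra.
by apply: Rle_Rpower => //; rewrite /=; lra.
Qed.

(* The word bound n ^ k means words of k * log2 n bits. *)
Theorem theorem5 :
  exists (P : cmd) (k : nat) (C : R),
  forall (n : nat) (e : rel 'I_n),
    simple_graph e -> connected_graph e -> no_isolated e -> AT_free e ->
    exists (t : nat) (s : state) (D : {set 'I_n}),
      [/\ exec (n ^ k) P (input_state e) t s,
          (INR t <= C * Rpower (INR n) 8.5)%Re,
          outputs s D &
          minimum_paired_dominating e D].
Proof.
have [C hC] := time_bound_poly 16 prog.
(* Degrees add up under products, and 200 is a generous bound for every expression of [prog]; the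
   evaluation of [well_formed] below confirms it. *)
exists (compile 16 prog), 200, (INR C) => n e [es ei] [card conn] iso AT.
have n0 : 0 < n by rewrite card_ord in card.
(* A single vertex would be isolated. From n >= 2 on, powers of n exceed the constants of the
   program. *)
have n1 : 1 < n.
  have [u eu] := iso (Ordinal n0); rewrite ltn_neqAle n0 andbT.
  apply/eqP => n_1; subst n; by rewrite (ord1 u) (ord1 (Ordinal _)) ei in eu.
pose A := HS (fun x => if x == 0 then n else 0) (adj_cell e) (fun _ _ => 0).
have repA : represents n A (input_state e).
  by split=> // t i _ /=; rewrite adj_cell_out // leq_addr.
have n16 : 0 < n ^ 16 by rewrite expn_gt0 n0.
have bndA : bounded 16 n A.
  split=> //= [x|a].
    by case: eqP => // _; rewrite -[X in X < _]expn1 ltn_exp2l.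
  by apply: leq_ltn_trans (leq_b1 _) _; rewrite -(expn0 n) ltn_exp2l.
have [|t [s' [hex ht [_ _ hmem _] _]]] :=
  @sem_exec 16 200 n n1 isT isT prog A _ _ repA bndA; first by vm_compute.
have [D minD hD] := @prog_correct n e es ei n1 conn iso AT A (fun=> erefl) (fun=> erefl) (fun _ _ => erefl).
exists t, s', D; split=> //.
  apply: Rle_trans (cost_bound C n0); apply: le_INR; apply/leP.
  by apply: leq_trans ht _; apply: hC.
move=> i; rewrite hmem ?hD //; apply: leq_trans (ltn_ord i) _.
by rewrite -[X in X <= _]expn1 leq_pexp2l.
Qed.
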